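(* Let $H\in\mathbb{N}$, $d=3H+1$, $a\in\mathbb{R}$, $b\in(a,\infty)$, $f\in C([a,b],\mathbb{R})$, let $p\colon[a,b]\to(0,\infty)$ be Lipschitz continuous, and let $L\colon\mathbb{R}^d\to\mathbb{R}$ and $G\colon\mathbb{R}^d\to\mathbb{R}^d$ be the risk function and a generalized gradient function as defined in the context. Let $N\in\mathbb{N}\cap[1,H]$, $\rho\in[0,1)$, $x_0,x_1,\ldots,x_N,\alpha_1,\alpha_2,\ldots,\alpha_N\in\mathbb{R}$ satisfy $a=x_0<x_1<\cdots<x_N=b$, assume for all $i\in\{1,\ldots,N\}$, $x\in[x_{i-1},x_i]$ that $f(x)=f(x_{i-1})+\alpha_i(x-x_{i-1})$, let $$D=1+|f(a)|+\bigl(1+2\max_{j\in\{1,\ldots,N\}}|\alpha_j|\bigr)(|a|+|b|+1),$$ and let $\Theta^{\theta,\gamma}\colon\mathbb{N}_0\to\mathbb{R}^d$, $\theta\in\mathbb{R}^d$, $\gamma\in\mathbb{R}$, satisfy for all $\theta\in\mathbb{R}^d$, $\gamma\in\mathbb{R}$, $n\in\mathbb{N}$ that $\Theta_0^{\theta,\gamma}=\theta$ and $\Theta_n^{\theta,\gamma}=\Theta_{n-1}^{\theta,\gamma}-\frac{\gamma}{n^\rho}G(\Theta_{n-1}^{\theta,\gamma})$. Then there exist $c,C\in(0,\infty)$ and a non-empty open set $U\subseteq(-D,D)^d$ such that for all $\theta\in U$, all $\gamma\in\bigl(0,\bigl((3N+1)(24D^5+16ND^7)\sup_{x\in[a,b]}p(x)\bigr)^{-1}\bigr]$,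 and all $n\in\mathbb{N}_0$ it holds that $$L(\Theta_n^{\theta,\gamma})\le C\exp(-c\gamma n^{1-\rho}).$$
   Context: $\mathbb{N}=\{1,2,\ldots\}$, $\mathbb{N}_0=\mathbb{N}\cup\{0\}$. The risk function $L\colon\mathbb{R}^d\to\mathbb{R}$ is given for $\theta=(\theta_1,\ldots,\theta_d)\in\mathbb{R}^d$ by $$L(\theta)=\int_a^b\Bigl(\theta_d+\sum_{j=1}^H\theta_{2H+j}\max\{\theta_jy+\theta_{H+j},0\}-f(y)\Bigr)^2p(y)\,\mathrm{d}y.$$ Let $\chi_r\in C^1(\mathbb{R},\mathbb{R})$, $r\in\mathbb{N}$, satisfy for all $x\in\mathbb{R}$ that $\sup_{r\in\mathbb{N}}\sup_{y\in[-|x|,|x|]}|(\chi_r)'(y)|<\infty$ and $\limsup_{r\to\infty}\bigl(|\chi_r(x)-\max\{x,0\}|+|(\chi_r)'(x)-\mathbf{1}_{(0,\infty)}(x)|\bigr)=0$, and for $r\in\mathbb{N}$, $\theta\in\mathbb{R}^d$ let $$\mathfrak{L}_r(\theta)=\int_a^b\Bigl(f(y)-\theta_d-\sum_{j=1}^H\theta_{2H+j}\,\chi_r(\theta_jy+\theta_{H+j})\Bigr)^2p(y)\,\mathrm{d}y.$$ $G\colon\mathbb{R}^d\to\mathbb{R}^d$ is any function satisfying for all $\theta\in\{\vartheta\in\mathbb{R}^d:((\nabla\mathfrak{L}_r)(\vartheta))_{r\in\mathbb{N}}\text{ is convergent}\}$ that $G(\theta)=\lim_{r\to\infty}(\nabla\mathfrak{L}_r)(\theta)$.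 *)

(* Defs.v *)
From HB Require Import structures.
From mathcomp Require Import all_boot all_order all_algebra.
From mathcomp Require Import all_classical all_reals all_analysis.
Set Implicit Arguments.
Unset Strict Implicit.
Unset Printing Implicit Defensive.
Import Order.TTheory GRing.Theory Num.Theory.
Import numFieldNormedType.Exports.
Local Open Scope classical_set_scope.
Local Open Scope ring_scope.

(* Coordinates are numbered from 1: coord theta k is theta_k, 1 <= k <= n.+1. *)
Definition coord (R : realType) (n : nat) (theta : 'rV[R]_n.+1) (k : nat) : R :=
  theta 0 (inord k.-1).

Definition gradient (R : realType) (n : nat) (F : 'rV[R]_n -> R)
    (theta : 'rV[R]_n) : 'rV[R]_n :=
  \row_(i < n) 'D_(delta_mx 0 i) F theta.

(* The parameter space is R^d with d = 3H+1, written (3 * H).+1. *)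
Definition risk (R : realType) (H : nat) (a b : R) (f p : R -> R)
    (theta : 'rV[R]_(3 * H).+1) : R :=
  \int[lebesgue_measure]_(y in `[a, b])
    ((coord theta (3 * H + 1)
      + \sum_(1 <= j < H.+1) coord theta (2 * H + j)
          * Num.max (coord theta j * y + coord theta (H + j)) 0
      - f y) ^+ 2 * p y).

Definition approx_risk (R : realType) (H : nat) (a b : R) (f p : R -> R)
    (chi : R -> R) (theta : 'rV[R]_(3 * H).+1) : R :=
  \int[lebesgue_measure]_(y in `[a, b])
    ((f y - coord theta (3 * H + 1)
      - \sum_(1 <= j < H.+1) coord theta (2 * H + j)
          * chi (coord theta j * y + coord theta (H + j))) ^+ 2 * p y).

(* Sequences indexed by {1, 2, ...} are functions on nat whose value at 0 is
   left unconstrained. *)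
Definition relu_approximation (R : realType) (chi : nat -> R -> R) : Prop :=
  [/\ forall r, (0 < r)%N ->
        (forall x, derivable (chi r) x 1) /\ continuous (derive1 (chi r)),
      forall x : R,
        (ereal_sup [set z : \bar R | exists r y,
           [/\ (0 < r)%N, (y \in `[- `|x|, `|x|])%R
             & z = (`| derive1 (chi r) y |)%:E]] < +oo)%E
    & forall x : R,
        limn_esup (fun r =>
          (`| chi r x - Num.max x 0 |
           + `| derive1 (chi r) x - \1_(`]0, +oo[%classic) x |)%:E) = 0%E].

Definition generalized_gradient (R : realType) (H : nat) (a b : R)
    (f p : R -> R) (chi : nat -> R -> R)
    (G : 'rV[R]_(3 * H).+1 -> 'rV[R]_(3 * H).+1) : Prop :=
  forall theta,
    cvgn (fun r => gradient (approx_risk a b f p (chi r)) theta) ->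
    G theta = limn (fun r => gradient (approx_risk a b f p (chi r)) theta).

(* Main.v *)
(* Near a network that represents f exactly, a Polyak-Lojasiewicz inequality holds and
   each gradient step decreases the risk L. The teacher uses neurons relu (y - xi_j)
   with one knot at a - 1 (always active), knots at the interior break points, and
   knots at b + 1 for the neurons which are not needed (always inactive).

   For a parameter theta near the teacher, the residual r = N_theta - f is the derivative
   of N_theta in an explicit direction u, plus an error that lives between the knots of
   theta and the break points of f. On the bulk of each affine piece r is affine, so its
   coefficients, hence u, r and the error, are all O(sqrt L). As the error is supported in
   a set of small measure, 2 int r (dN_theta u) p = <G theta, u> gives
   L <= <G theta, u> <= K sqrt L |G theta|. The same smallness controls the
   non-differentiability of L along a step: L (theta - h G) <= L theta - h |G|^2 / 2, where
   the quadratic term is absorbed by the bound on gamma. These estimates make the step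
   lengths telescope in sqrt L, so iterates stay near the teacher and L decays like
   exp (- c sum_k h_k), with sum_(k <= n) k^(-rho) >= n^(1 - rho). That G is the expected
   gradient formula follows from differentiation under the integral and dominated
   convergence. *)
Require Import Defs.
From HB Require Import structures.
From mathcomp Require Import all_boot all_order all_algebra.
From mathcomp Require Import all_classical all_reals all_analysis.
From mathcomp Require Import measurable_realfun.
From mathcomp Require Import zify ring lra.
Set Implicit Arguments.
Unset Strict Implicit.
Unset Printing Implicit Defensive.
Import Order.TTheory GRing.Theory Num.Theory.
Import numFieldNormedType.Exports.
Local Open Scope classical_set_scope.
Local Open Scope ring_scope.

(* The unqualified name refers to vector.coord of MathComp. *)
Local Notation coord := (@Defs.coord _ _).

(** * Weighted integrals of bounded measurable functions *)

(** Exact representations of f form a continuum: rescaling a neuron, or shifting a constant between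
    the first neuron and the output bias, changes nothing. Hence L controls no distance to the
    teacher, only the combinations of parameters visible in the residual, and u is built from these
    alone. The obstacle is the kinks. Where the activations of theta and of the teacher differ, an
    error of size O(eps) would not be dominated by L. But there the two weighted pre-activations
    have opposite signs, so the error is at most their difference, which is O(sqrt L). Paired with
    the residual it becomes O(L) with a small factor eta. The bound on gamma enters once. Near the
    teacher the network is Lipschitz in theta with constant (2N+1)D^2, so 4(2N+1)^2 D^5 (sup p) h <=
    1 keeps the quadratic term of a step below h|G|^2/4; the kink and product terms share the other
    h|G|^2/4. Norms are maximum norms while the pairing with G is Euclidean. This costs a factor
    3H+1 in the Polyak-Lojasiewicz inequality and nothing in the descent. *)

Section WeightedIntegral.
Variables (R : realType) (a b : R).
Local Notation mu := (@lebesgue_measure R).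

(** Activation indicators make the integrands discontinuous. This class contains them, is closed
    under the algebra used below, and consists of integrable functions on the segment. *)
Definition bounded_measurable (g : R -> R) : Prop :=
  measurable_fun `[a, b] g /\
  exists M : R, forall y, y \in `[a, b] -> `|g y| <= M.

Lemma bounded_measurable_cst (c : R) : bounded_measurable (fun=> c).
Proof. by split; [exact: measurable_cst|exists `|c|]. Qed.

Lemma bounded_measurableD g h : bounded_measurable g -> bounded_measurable h ->
  bounded_measurable (fun y => g y + h y).
Proof.
move=> [mg [M gM]] [mh [K hK]]; split; first exact: measurable_funD.
by exists (M + K) => y yab; rewrite (le_trans (ler_normD _ _))// lerD ?gM ?hK.
Qed.

Lemma bounded_measurableM g h : bounded_measurable g -> bounded_measurable h ->
  bounded_measurable (fun y => g y * h y).
Proof.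
move=> [mg [M gM]] [mh [K hK]]; split; first exact: measurable_funM.
by exists (M * K) => y yab; rewrite normrM ler_pM ?gM ?hK.
Qed.

Lemma bounded_measurableB g h : bounded_measurable g -> bounded_measurable h ->
  bounded_measurable (fun y => g y - h y).
Proof.
move=> [mg [M gM]] [mh [K hK]]; split; first exact: measurable_funB.
by exists (M + K) => y yab; rewrite (le_trans (ler_normB _ _))// lerD ?gM ?hK.
Qed.

Lemma bounded_measurableX g n : bounded_measurable g ->
  bounded_measurable (fun y => g y ^+ n).
Proof.
move=> [mg [M gM]]; split; first exact: measurable_funX.
exists (M ^+ n) => y yab; have gMy := gM y yab.
by rewrite normrX lerXn2r// nnegrE (le_trans _ gMy).
Qed.

Lemma bounded_measurable_norm g : bounded_measurable g ->
  bounded_measurable (fun y => `|g y|).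
Proof.
move=> [mg [M gM]]; split; first exact: measurableT_comp.
by exists M => y yab; rewrite normr_id gM.
Qed.

Lemma bounded_measurable_sum (I : Type) (s : seq I) (h : I -> R -> R) :
  (forall i, bounded_measurable (h i)) ->
  bounded_measurable (fun y => \sum_(i <- s) h i y).
Proof.
move=> bh; elim: s => [|i s ih].
  by under eq_fun do rewrite big_nil; exact: bounded_measurable_cst.
by under eq_fun do rewrite big_cons; exact: bounded_measurableD.
Qed.

Lemma within_continuous_bounded_measurable g :
  {within `[a, b], continuous g} -> bounded_measurable g.
Proof.
move=> cg; split; first exact: subspace_continuous_measurable_fun.
have /compact_bounded[M [_ gM]] := continuous_compact cg (@segment_compact R a b).
exists (M + 1) => y yab; apply: gM; first by rewrite ltrDl.
by exists y.
Qed.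

Lemma continuous_bounded_measurable g : continuous g -> bounded_measurable g.
Proof.
by move=> cg; apply: within_continuous_bounded_measurable; exact: continuous_subspaceT.
Qed.

Lemma bounded_measurable_integrable g :
  bounded_measurable g -> mu.-integrable `[a, b] (EFin \o g).
Proof.
move=> [mg [M gM]]; apply: measurable_bounded_integrable => //.
  by rewrite /= lebesgue_measure_itv/=; case: ifP => // _; rewrite -EFinB ltry.
exists M; split; first exact: num_real.
by move=> K MK y yab; apply: le_trans (gM y yab) (ltW MK).
Qed.

Variable p : R -> R.

Definition wint (g : R -> R) : R := \int[mu]_(y in `[a, b]) (g y * p y).

Hypothesis bp : bounded_measurable p.

Lemma eq_wint g h : (forall y, y \in `[a, b] -> g y = h y) -> wint g = wint h.
Proof. by move=> gh; apply: eq_Rintegral => y; rewrite inE/= => yab; rewrite gh. Qed.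

Let integ g : bounded_measurable g -> mu.-integrable `[a, b] (EFin \o (fun y => g y * p y)).
Proof. by move=> bg; apply: bounded_measurable_integrable; exact: bounded_measurableM. Qed.

Lemma wintD g h : bounded_measurable g -> bounded_measurable h ->
  wint (fun y => g y + h y) = wint g + wint h.
Proof.
move=> bg bh; rewrite /wint -RintegralD//; do ?exact: integ.
by apply: eq_Rintegral => y _; rewrite mulrDl.
Qed.

Lemma wintZ (c : R) g : bounded_measurable g -> wint (fun y => c * g y) = c * wint g.
Proof.
move=> bg; rewrite /wint -RintegralZl//; last exact: integ.
by apply: eq_Rintegral => y _; rewrite mulrA.
Qed.

Lemma wint_sum (I : Type) (s : seq I) (h : I -> R -> R) :
  (forall i, bounded_measurable (h i)) ->
  wint (fun y => \sum_(i <- s) h i y) = \sum_(i <- s) wint (h i).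
Proof.
move=> bh; elim: s => [|i s ih].
  rewrite big_nil /wint; under eq_Rintegral do rewrite big_nil mul0r.
  by rewrite Rintegral_cst// mul0r.
rewrite big_cons -ih -wintD//; last exact: bounded_measurable_sum.
by apply: eq_wint => y _; rewrite big_cons.
Qed.

Hypothesis p0 : forall y, y \in `[a, b] -> 0 <= p y.

Lemma le_wint g h : bounded_measurable g -> bounded_measurable h ->
  (forall y, y \in `[a, b] -> g y <= h y) -> wint g <= wint h.
Proof.
move=> bg bh gh; apply: le_Rintegral => //; do ?exact: integ.
by move=> y yab; apply: ler_wpM2r; [exact: p0|exact: gh].
Qed.

Lemma wint_ge0 g : (forall y, y \in `[a, b] -> 0 <= g y) -> 0 <= wint g.
Proof. by move=> g0; apply: Rintegral_ge0 => y yab; rewrite mulr_ge0 ?g0 ?p0. Qed.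

Lemma normr_wint g : bounded_measurable g -> `|wint g| <= wint (fun y => `|g y|).
Proof.
move=> bg; rewrite (le_trans (le_normr_Rintegral _ _))//; first exact: integ.
rewrite le_eqVlt; apply/orP; left; apply/eqP/eq_Rintegral => y.
by rewrite inE/= => yab; rewrite normrM (ger0_norm (p0 yab)).
Qed.

Hypothesis ab : a < b.
Variable P : R.
Hypothesis pP : forall y, y \in `[a, b] -> p y <= P.

Lemma Rintegral_itv_cst (c d r : R) : c <= d ->
  \int[mu]_(y in `[c, d]) r = r * (d - c).
Proof.
move=> cd; rewrite Rintegral_cst//=; congr (_ * _).
rewrite lebesgue_measure_itv/= lte_fin.
by move: cd; rewrite le_eqVlt => /predU1P[->|->]; rewrite ?ltxx ?subrr.
Qed.

Lemma wint_cst_le (c : R) : 0 <= c -> wint (fun=> c) <= c * P * (b - a).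
Proof.
move=> c0; rewrite -Rintegral_itv_cst ?(ltW ab)//.
apply: le_Rintegral => //.
- exact: (integ (bounded_measurable_cst c)).
- exact: (bounded_measurable_integrable (bounded_measurable_cst _)).
- by move=> y yab; rewrite ler_wpM2l// pP.
Qed.

Lemma wint_le g (c : R) : bounded_measurable g -> 0 <= c ->
  (forall y, y \in `[a, b] -> g y <= c) -> wint g <= c * P * (b - a).
Proof.
move=> bg c0 gc; rewrite (le_trans _ (wint_cst_le c0))//.
by apply: le_wint => //; exact: bounded_measurable_cst.
Qed.

Lemma bounded_measurable_bool (q : R -> bool) :
  measurable_fun `[a, b] q -> bounded_measurable (fun y => (q y)%:R).
Proof.
move=> mq; split.
  rewrite (_ : (fun y => (q y)%:R) = (fun y => if q y then 1 else 0)).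
    by apply: measurable_fun_if => //; exact: measurable_cst.
  by apply/funext => y; case: (q y).
by exists 1 => y _; case: (q y); rewrite ?normr1 ?normr0.
Qed.

Lemma bounded_measurable_near (x eta : R) :
  bounded_measurable (fun y => ((`|y - x| < eta)%R)%:R).
Proof.
apply: (@bounded_measurable_bool (fun y => `|y - x| < eta)).
have mn : measurable_fun `[a, b] (fun y : R => `|y - x|).
  by apply: measurableT_comp => //; apply: measurable_funB.
by have := @measurable_fun_ltr _ _ R `[a, b]%classic _ (fun=> eta) mn (measurable_cst _); apply.
Qed.

(** All errors caused by kinks live on such neighbourhoods of knots; this bound is the source of the
    small factor [eta]. *)
Lemma wint_near_le (x eta : R) : 0 <= eta ->
  wint (fun y => ((`|y - x| < eta)%R)%:R) <= 2 * eta * P.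
Proof.
move=> eta0.
have P0 : 0 <= P.
  have aab : a \in `[a, b] by rewrite in_itv/= lexx ltW.
  exact: le_trans (p0 aab) (pP aab).
pose S := `[x - eta, x + eta]%classic.
have mS : measurable S by exact: measurable_itv.
have bS : bounded_measurable (\1_S : R -> R).
  split; first exact: measurable_indic.
  by exists 1 => y _; rewrite indicE; case: (y \in S); rewrite ?normr1 ?normr0.
apply: (@le_trans _ _ (\int[mu]_(y in `[a, b]) (P * \1_S y))).
  apply: le_Rintegral => //; first exact: (integ (bounded_measurable_near _ _)).
    by apply: bounded_measurable_integrable; apply: bounded_measurableM => //; exact: bounded_measurable_cst.
  move=> y yab; rewrite mulrC indicE; have [h|_] := boolP (`|y - x| < eta); last first.
    by rewrite mulr0 mulr_ge0.
  rewrite mem_set ?mulr1; first exact: pP.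
  by rewrite /S/= in_itv/=; move: (ltW h); rewrite ler_distl => /andP[-> ->].
rewrite RintegralZl//; last exact: bounded_measurable_integrable.
rewrite mulrC ler_wpM2r// /Rintegral integral_indic//=.
have le2 : (mu (S `&` `[a, b]) <= (2 * eta)%:E)%E.
  rewrite (le_trans (le_measure mu _ _ (@subIsetl _ _ _)))// ?inE//=.
    exact: measurableI.
  rewrite /S lebesgue_measure_itv/= lte_fin; case: ifPn => _.
    by rewrite -EFinB lee_fin; lra.
  by rewrite lee_fin mulr_ge0.
rewrite -lee_fin fineK// ge0_fin_numE//.
exact: le_lt_trans le2 (ltry _).
Qed.

End WeightedIntegral.

(** * Networks and their derivatives in the parameters *)

Definition relu (R : realType) (z : R) : R := Num.max z 0.
(** The value 0 at 0 is the one forced by the pointwise limit of the derivatives of [chi r]. *)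
Definition heaviside (R : realType) (z : R) : R := ((0 < z)%R)%:R.

Section Network.
Variables (R : realType) (H : nat).
Implicit Types (theta V : 'rV[R]_(3 * H).+1) (act dact : R -> R).

Lemma coordD theta V k : coord (theta + V) k = coord theta k + coord V k.
Proof. by rewrite /coord mxE. Qed.

Lemma coordZ (t : R) theta k : coord (t *: theta) k = t * coord theta k.
Proof. by rewrite /coord mxE. Qed.

(** The norm of a row vector is the maximum norm. *)
Lemma normr_rV_le n (v : 'rV[R]_n) i : `|v 0 i| <= `|v|.
Proof.
by rewrite [leRHS]/Num.Def.normr /= mx_normrE; apply/bigmax_geP; right => /=; exists (0, i).
Qed.

Lemma normr_coord_le theta k : `|coord theta k| <= `|theta|.
Proof. exact: normr_rV_le. Qed.

Definition neuron theta (j : nat) (y : R) : R :=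
  coord theta j * y + coord theta (H + j).

Definition network act theta (y : R) : R :=
  coord theta (3 * H + 1)
  + \sum_(1 <= j < H.+1) coord theta (2 * H + j) * act (neuron theta j y).

(** Chain rule in direction [V], with [dact] as a separate argument: for [chi r] it is a true
    derivative, for [relu] and [heaviside] only a formal one. *)
Definition dnetwork act dact theta V (y : R) : R :=
  coord V (3 * H + 1)
  + \sum_(1 <= j < H.+1)
      (coord V (2 * H + j) * act (neuron theta j y)
       + coord theta (2 * H + j) * (dact (neuron theta j y) * neuron V j y)).

Lemma neuron_line (t : R) theta V j y :
  neuron (t *: V + theta) j y = t * neuron V j y + neuron theta j y.
Proof. by rewrite /neuron !coordD !coordZ; ring. Qed.

Lemma is_derive_big_seq (I : Type) (s : seq I) (h : I -> R -> R) (dh : I -> R) (x : R) :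
  (forall i, is_derive x 1 (h i) (dh i)) ->
  is_derive x 1 (fun t => \sum_(i <- s) h i t) (\sum_(i <- s) dh i).
Proof.
move=> hd; elim: s => [|i s ih].
  rewrite big_nil; under eq_fun do rewrite big_nil.
  exact: is_derive_cst.
rewrite big_cons; under eq_fun do rewrite big_cons.
exact: is_deriveD.
Qed.

Lemma is_derive_affine (m n t : R) : is_derive t 1 (fun t => t * m + n) m.
Proof.
have h : is_derive t 1 (fun t : R => t * m + n) (t *: 0 + m *: 1 + 0).
  exact: is_deriveD.
by apply: is_derive_eq h _; rewrite scaler0 add0r addr0 /GRing.scale/= mulr1.
Qed.

Lemma is_derive_network (chi : R -> R) : (forall x, derivable chi x 1) ->
  forall theta V (y t : R),
  is_derive t 1 (fun t => network chi (t *: V + theta) y)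
    (dnetwork chi (derive1 chi) (t *: V + theta) V y).
Proof.
move=> dchi theta V y t; rewrite /network /dnetwork.
have coordE k u : coord (u *: V + theta) k = u * coord V k + coord theta k.
  by rewrite coordD coordZ.
apply: is_deriveD.
  under eq_fun do rewrite coordE; exact: is_derive_affine.
apply: is_derive_big_seq => j.
under eq_fun do rewrite coordE neuron_line.
rewrite coordE neuron_line.
have h : is_derive t 1 (fun u => chi (u * neuron V j y + neuron theta j y))
    (derive1 chi (t * neuron V j y + neuron theta j y) * neuron V j y).
  apply: (@is_derive1_comp _ chi (fun u => u * neuron V j y + neuron theta j y));
    last exact: is_derive_affine.
  by rewrite derive1E; exact: derivableP.
apply: is_derive_eq (is_deriveM (is_derive_affine _ _ _) h) _.
rewrite /GRing.scale/=; ring.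
Qed.

Lemma normr_neuron_le theta W (a b : R) j y : `|theta| <= W -> y \in `[a, b] ->
  `|neuron theta j y| <= W * (`|a| + `|b| + 1).
Proof.
move=> tW yab.
have yM : `|y| <= `|a| + `|b|.
  rewrite ler_norml; move: yab; rewrite in_itv/= => /andP[ay yb].
  have := ler_norm b; have := ler_norm (- a); rewrite normrN.
  have := normr_ge0 a; have := normr_ge0 b; lra.
rewrite /neuron (le_trans (ler_normD _ _))// normrM.
have c1 := le_trans (normr_coord_le theta j) tW.
have c2 := le_trans (normr_coord_le theta (H + j)) tW.
by rewrite mulrDr mulr1 lerD// ler_pM.
Qed.

Lemma normr_network_le act theta (W A a b y : R) :
  `|theta| <= W -> y \in `[a, b] ->
  (forall z, `|z| <= W * (`|a| + `|b| + 1) -> `|act z| <= A) ->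
  `|network act theta y| <= W + H%:R * (W * A).
Proof.
move=> tW yab actA.
have cW k := le_trans (normr_coord_le theta k) tW.
rewrite (le_trans (ler_normD _ _))// lerD//.
rewrite (le_trans (ler_norm_sum _ _ _))//.
apply: (@le_trans _ _ (\sum_(1 <= j < H.+1) W * A)); last first.
  by rewrite sumr_const_nat subn1 mulr_natl.
apply: ler_sum => j _.
by rewrite normrM ler_pM// actA// (normr_neuron_le _ tW yab).
Qed.

Lemma normr_dnetwork_le act dact theta V (W A B a b y : R) :
  `|theta| <= W -> `|V| <= W -> y \in `[a, b] ->
  (forall z, `|z| <= W * (`|a| + `|b| + 1) -> `|act z| <= A) ->
  (forall z, `|z| <= W * (`|a| + `|b| + 1) -> `|dact z| <= B) ->
  `|dnetwork act dact theta V y|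
    <= W + H%:R * (W * A + W * (B * (W * (`|a| + `|b| + 1)))).
Proof.
move=> tW vW yab actA dactB.
have cW k := le_trans (normr_coord_le theta k) tW.
have dW k := le_trans (normr_coord_le V k) vW.
rewrite (le_trans (ler_normD _ _))// lerD//.
rewrite (le_trans (ler_norm_sum _ _ _))//.
apply: (@le_trans _ _
    (\sum_(1 <= j < H.+1) (W * A + W * (B * (W * (`|a| + `|b| + 1)))))); last first.
  by rewrite sumr_const_nat subn1 mulr_natl.
apply: ler_sum => j _.
rewrite (le_trans (ler_normD _ _))// !normrM.
have nj := normr_neuron_le j tW yab; have nv := normr_neuron_le j vW yab.
rewrite lerD//; first by rewrite ler_pM// actA// (le_trans nj).
by rewrite ler_pM ?mulr_ge0// ler_pM// dactB.
Qed.

Lemma neuron_continuous theta j : continuous (neuron theta j).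
Proof.
move=> y; apply: cvgD; last exact: cvg_cst.
by apply: cvgM; [exact: cvg_cst|exact: cvg_id].
Qed.

Lemma cvg_big_seq (T I : Type) (F : set_system T) (FF : Filter F) (s : seq I)
    (h : I -> T -> R) (l : I -> R) :
  (forall i, h i t @[t --> F] --> l i) ->
  \sum_(i <- s) h i t @[t --> F] --> \sum_(i <- s) l i.
Proof.
move=> hl; elim: s => [|i s ih].
  by rewrite big_nil; under eq_fun do rewrite big_nil; exact: cvg_cst.
by rewrite big_cons; under eq_fun do rewrite big_cons; exact: cvgD.
Qed.

Lemma network_continuous act theta : continuous act -> continuous (network act theta).
Proof.
move=> cact y; apply: cvgD; first exact: cvg_cst.
apply: cvg_big_seq => j; apply: cvgM; first exact: cvg_cst.
by apply: continuous_comp; [exact: neuron_continuous|exact: cact].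
Qed.

Lemma dnetwork_continuous act dact theta V : continuous act -> continuous dact ->
  continuous (dnetwork act dact theta V).
Proof.
move=> cact cdact y; apply: cvgD; first exact: cvg_cst.
apply: cvg_big_seq => j; apply: cvgD; apply: cvgM; try exact: cvg_cst.
  by apply: continuous_comp; [exact: neuron_continuous|exact: cact].
apply: cvgM; last exact: neuron_continuous.
by apply: continuous_comp; [exact: neuron_continuous|exact: cdact].
Qed.

End Network.

(** * Limits and uniform bounds for the smooth approximations of the ReLU *)

Section ReluApproximation.
Variables (R : realType) (chi : nat -> R -> R).
Hypothesis hchi : relu_approximation chi.

Lemma relu_approximation_cvg (x : R) :
  chi r x @[r --> \oo] --> relu x /\ derive1 (chi r) x @[r --> \oo] --> heaviside x.
Proof.
case: hchi => _ _ /(_ x) lim0.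
set u := fun r => _ in lim0.
have u0 : u r @[r --> \oo] --> 0%E.
  apply: limn_esup_le_cvg; first by rewrite lim0.
  by move=> r; rewrite /u lee_fin addr_ge0.
have v0 : `| chi r x - relu x | + `| derive1 (chi r) x - heaviside x | @[r --> \oo] --> (0:R).
  rewrite [X in X @ _ --> _](_ : _ = fine \o u); first exact: fine_cvg.
  apply/funext => r; rewrite /u /heaviside indicE /=; congr (_ + `| _ - _|).
  rewrite -[(0 < x)%R](_ : (x \in `]0, +oo[%classic) = _)//; apply/idP/idP.
    by rewrite inE/= in_itv/= andbT.
  by move=> x0; rewrite inE/= in_itv/= x0.
split; apply: (@cvg_zero _ R^o); apply: norm_cvg0; apply: (squeeze_cvgr _ (cvg_cst 0) v0);
  by apply: nearW => r; rewrite normr_ge0/= ?lerDl ?lerDr.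
Qed.

(** Only the derivatives are assumed to be uniformly bounded. The values follow by the mean value
    theorem from [chi r 0], which tends to 0 and is therefore bounded by 1 from some index on. *)
Lemma relu_approximation_bounded (Z : R) : 0 <= Z ->
  exists (A B : R) (r0 : nat), forall r, (r0 <= r)%N -> (0 < r)%N /\ forall z, `|z| <= Z ->
    `|chi r z| <= A /\ `|derive1 (chi r) z| <= B.
Proof.
move=> Z0; case: (hchi) => dchi /(_ Z) supfin _.
set S := ereal_sup _ in supfin.
pose B := fine S.
have dB r z : (0 < r)%N -> `|z| <= Z -> `|derive1 (chi r) z| <= B.
  move=> r0 zZ.
  have h : ((`|derive1 (chi r) z|)%:E <= S)%E.
    apply: ereal_sup_ubound; exists r, z; split => //.
    by rewrite in_itv/= (ger0_norm Z0) -ler_norml.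
  rewrite -lee_fin fineK// fin_numE; move: h supfin; case: (S) => //=.
have [c0 _] := relu_approximation_cvg 0.
have /cvgrPdist_lt/(_ 1 ltr01)[r1 _ hr1] := c0.
(* The successor also excludes the index 0, where [chi] is arbitrary. *)
exists (1 + B * Z), B, r1.+1 => r rr1.
have r0 : (0 < r)%N by exact: leq_trans rr1.
split=> // z zZ; split; last exact: dB.
have B0 : 0 <= B by apply: le_trans (dB r z r0 zZ).
have chi0 : `|chi r 0| <= 1.
  have := hr1 r (ltnW rr1).
  by rewrite /= /relu maxxx sub0r normrN => /ltW.
have [dr cr] := dchi r r0.
have dr' (x : R) : is_derive x 1 (chi r) (derive1 (chi r) x).
  by rewrite derive1E; exact: derivableP.
have cchi : continuous (chi r).
  by move=> x; apply: differentiable_continuous; apply/derivable1_diffP.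
suff mvt : `|chi r z - chi r 0| <= B * Z.
  rewrite -(subrK (chi r 0) (chi r z)) (le_trans (ler_normD _ _))// addrC lerD//.
have [z0|z0] := leP 0 z.
  have [c] := MVT_segment z0 (fun x _ => dr' x) (continuous_subspaceT cchi).
  rewrite in_itv/= => /andP[c0' cz] ->; rewrite normrM subr0 ler_pM//.
  apply: dB => //; rewrite ger0_norm//; apply: le_trans cz (le_trans _ zZ).
  exact: ler_norm.
have [c] := MVT_segment (ltW z0) (fun x _ => dr' x) (continuous_subspaceT cchi).
rewrite in_itv/= => /andP[cz c0'] e; rewrite distrC e normrM sub0r normrN ler_pM//.
apply: dB => //; rewrite ler0_norm//; apply: le_trans _ zZ.
by rewrite (ltr0_norm z0) lerN2.
Qed.

End ReluApproximation.

(** * The generalized gradient *)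

Lemma reluE (R : realType) (z : R) : relu z = heaviside z * z.
Proof. by rewrite /relu /heaviside; case: ltP; rewrite (mul1r, mul0r). Qed.

Section BoundedMeasurableNetwork.
Variables (R : realType) (H : nat) (a b : R).
Implicit Types theta V : 'rV[R]_(3 * H).+1.

Lemma bounded_measurable_neuron theta j : bounded_measurable a b (neuron theta j).
Proof. by apply: continuous_bounded_measurable; exact: neuron_continuous. Qed.

Lemma bounded_measurable_heaviside theta j :
  bounded_measurable a b (fun y => heaviside (neuron theta j y)).
Proof.
apply: (@bounded_measurable_bool _ _ _ (fun y => 0 < neuron theta j y)).
have mn : measurable_fun `[a, b] (neuron theta j) by case: (bounded_measurable_neuron theta j).
by have := @measurable_fun_ltr _ _ R `[a, b]%classic (fun=> 0) _ (measurable_cst _) mn; apply.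
Qed.

Lemma bounded_measurable_relu theta j :
  bounded_measurable a b (fun y => relu (neuron theta j y)).
Proof.
under eq_fun do rewrite reluE.
by apply: bounded_measurableM; [exact: bounded_measurable_heaviside
  |exact: bounded_measurable_neuron].
Qed.

Lemma bounded_measurable_network theta :
  bounded_measurable a b (network (@relu R) theta).
Proof.
apply: bounded_measurableD; first exact: bounded_measurable_cst.
apply: bounded_measurable_sum => j.
apply: bounded_measurableM; first exact: bounded_measurable_cst.
exact: bounded_measurable_relu.
Qed.

Lemma bounded_measurable_dnetwork theta V :
  bounded_measurable a b (dnetwork (@relu R) (@heaviside R) theta V).
Proof.
apply: bounded_measurableD; first exact: bounded_measurable_cst.
apply: bounded_measurable_sum => j; apply: bounded_measurableD.
  apply: bounded_measurableM; first exact: bounded_measurable_cst.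
  exact: bounded_measurable_relu.
apply: bounded_measurableM; first exact: bounded_measurable_cst.
apply: bounded_measurableM; first exact: bounded_measurable_heaviside.
exact: bounded_measurable_neuron.
Qed.

End BoundedMeasurableNetwork.

Section GradientLimit.
Variables (R : realType) (H : nat) (a b : R) (f p : R -> R) (chi : nat -> R -> R).
Hypotheses (bf : bounded_measurable a b f) (bp : bounded_measurable a b p).
Hypothesis hchi : relu_approximation chi.
Implicit Types theta V : 'rV[R]_(3 * H).+1.
Local Notation wint := (wint a b p).
Local Notation mu := (@lebesgue_measure R).

Lemma approx_riskE (c : R -> R) theta :
  approx_risk a b f p c theta = wint (fun y => (network c theta y - f y) ^+ 2).
Proof.
apply: eq_Rintegral => y _; congr (_ * _).
rewrite /network /neuron; ring.
Qed.

Lemma is_derive_sqr_residual (c : R -> R) : (forall x, derivable c x 1) ->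
  forall theta V (y t : R),
  is_derive t 1 (fun t => (network c (t *: V + theta) y - f y) ^+ 2 * p y)
    (2 * (network c (t *: V + theta) y - f y)
     * dnetwork c (derive1 c) (t *: V + theta) V y * p y).
Proof.
move=> dc theta V y t.
have dn := is_derive_network dc theta V y t.
have dr : is_derive t 1 (fun t => network c (t *: V + theta) y - f y)
    (dnetwork c (derive1 c) (t *: V + theta) V y - 0) by exact: is_deriveB.
have h := is_deriveM (is_deriveX 2 dr) (is_derive_cst (p y) t (1 : R)).
apply: is_derive_eq h _.
rewrite /GRing.scale/= !fctE/=; ring.
Qed.

Lemma normr_rV_line (t : R) theta V : t \in `]-1, 1[ ->
  `|t *: V + theta| <= `|V| + `|theta|.
Proof.
rewrite in_itv/= => /andP[t1 t2]; rewrite (le_trans (ler_normD _ _))// lerD2r normrZ.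
by rewrite ler_piMl// ler_norml !ltW.
Qed.

(** One constant serves two dominations: uniformity in [t] allows differentiation under the
    integral, and uniformity in [r] (at [t = 0]) allows dominated convergence. *)
Lemma network_line_bounded theta V : exists (K : R) (r0 : nat), forall r, (r0 <= r)%N ->
  (0 < r)%N /\ forall t y : R, t \in `]-1, 1[ -> y \in `[a, b] ->
  `|network (chi r) (t *: V + theta) y| <= K
  /\ `|dnetwork (chi r) (derive1 (chi r)) (t *: V + theta) V y| <= K.
Proof.
pose W := `|V| + `|theta|; pose Z := W * (`|a| + `|b| + 1).
have W0 : 0 <= W by rewrite addr_ge0.
have Z0 : 0 <= Z by rewrite mulr_ge0// !addr_ge0.
have [A [B [r0 hAB]]] := relu_approximation_bounded hchi Z0.
exists (Num.max (W + H%:R * (W * A)) (W + H%:R * (W * A + W * (B * Z)))), r0.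
move=> r rr0; have [rpos hr] := hAB r rr0; split=> // t y t1 yab.
have tW := normr_rV_line theta V t1.
have vW : `|V| <= W by rewrite lerDl.
rewrite !le_max; split; apply/orP; [left|right].
  by apply: (normr_network_le tW yab) => z zZ; case: (hr z zZ).
by apply: (normr_dnetwork_le tW vW yab) => z zZ; case: (hr z zZ).
Qed.

Let bn c theta : continuous c -> bounded_measurable a b (network c theta).
Proof. by move=> cc; apply: continuous_bounded_measurable; exact: network_continuous. Qed.

(** The risk is differentiated at [t = 0] along the line [t *: V + theta]. The identity is stated
    eventually because the dominating constant is available from [r0] on. *)
Lemma derive_approx_risk theta V : \forall r \near \oo,
  'D_V (approx_risk a b f p (chi r)) theta
  = wint (fun y => 2 * (network (chi r) theta y - f y)
                   * dnetwork (chi r) (derive1 (chi r)) theta V y).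
Proof.
have [K [r0 hK]] := network_line_bounded theta V.
exists r0 => // r /= rr0; have [rpos {}hK] := hK r rr0.
have [dchi _] : (forall x, derivable (chi r) x 1) /\ continuous (derive1 (chi r)).
  by case: hchi => /(_ r rpos).
have cchi : continuous (chi r).
  by move=> x; apply: differentiable_continuous; apply/derivable1_diffP.
have [[mf [F hF]] [mp [P hP]]] := (bf, bp).
pose g t y := (network (chi r) (t *: V + theta) y - f y) ^+ 2 * p y.
pose dg t y := 2 * (network (chi r) (t *: V + theta) y - f y)
     * dnetwork (chi r) (derive1 (chi r)) (t *: V + theta) V y * p y.
have gdg (t y : R) : is_derive t 1 (g^~ y) (dg t y) by exact: is_derive_sqr_residual.
have h01 : `]-1, 1[%classic (0 : R) by rewrite /= in_itv/=; apply/andP; split; lra.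
have gint (t : R) : `]-1, 1[%classic t -> mu.-integrable `[a, b] (EFin \o g t).
  move=> _; apply: bounded_measurable_integrable; apply: bounded_measurableM => //.
  by apply: bounded_measurableX; apply: bounded_measurableB => //; exact: bn.
have gder (t y : R) : `]-1, 1[%classic t -> `[a, b]%classic y -> derivable (g^~ y) t 1.
  by move=> _ _; exact: ex_derive.
pose C := `|2 * (K + F) * K * P|.
have C0 (y : R) : 0 <= C by exact: normr_ge0.
have Cint : mu.-integrable `[a, b] (EFin \o (fun=> C)).
  by apply: bounded_measurable_integrable; exact: bounded_measurable_cst.
have gub (t y : R) : `]-1, 1[%classic t -> `[a, b]%classic y -> `|partial1of2 g t y| <= C.
  move=> t1 yab; rewrite partial1of2E (@derive_val _ _ _ _ _ _ _ (gdg t y)).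
  have [n1 n2] := hK t y t1 yab.
  apply: le_trans (ler_norm _); rewrite !normrM normr_nat.
  rewrite ler_pM ?mulr_ge0 ?hP// ler_pM ?mulr_ge0// ler_pM// .
  by rewrite (le_trans (ler_normB _ _))// lerD// hF.
have := @cvg_differentiation_under_integral R _ _ mu g _ (measurable_itv `[a, b])
  0 (-1) 1 h01 gint gder (fun=> C) C0 Cint gub.
have -> : \int[mu]_(y in `[a, b]) partial1of2 g 0 y
    = wint (fun y => 2 * (network (chi r) theta y - f y)
                     * dnetwork (chi r) (derive1 (chi r)) theta V y).
  apply: eq_Rintegral => y _.
  by rewrite partial1of2E (@derive_val _ _ _ _ _ _ _ (gdg 0 y)) /dg scale0r add0r.
move=> lim; apply: (cvg_lim (@Rhausdorff R)); move: lim.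
apply: cvg_trans; apply: near_eq_cvg; apply: nearW => h /=.
by rewrite addr0 !approx_riskE /g scale0r add0r.
Qed.

Lemma cvg_gradient theta V :
  'D_V (approx_risk a b f p (chi r)) theta @[r --> \oo]
  --> wint (fun y => 2 * (network (@relu R) theta y - f y)
                     * dnetwork (@relu R) (@heaviside R) theta V y).
Proof.
have [K [r0 hK]] := network_line_bounded theta V.
pose h r y := 2 * (network (chi r) theta y - f y)
     * dnetwork (chi r) (derive1 (chi r)) theta V y.
suff : wint (h r) @[r --> \oo] --> wint (fun y => 2 * (network (@relu R) theta y - f y)
                     * dnetwork (@relu R) (@heaviside R) theta V y).
  apply: cvg_trans; apply: near_eq_cvg.
  by near=> r; apply: esym; near: r; exact: derive_approx_risk.
have [[mf [F hF]] [mp [P hP]]] := (bf, bp).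
pose C := `|2 * (K + F) * K * P|.
(* After a shift by [r0] the dominating constant applies to every index. *)
rewrite -(cvg_shiftn r0); apply: fine_cvg; rewrite fineK; last first.
  apply: integrable_fin_num => //; apply: bounded_measurable_integrable.
  apply: bounded_measurableM => //; apply: bounded_measurableM.
    apply: bounded_measurableM; first exact: bounded_measurable_cst.
    by apply: bounded_measurableB => //; exact: bounded_measurable_network.
  exact: bounded_measurable_dnetwork.
apply: (@dominated_cvg _ _ _ mu _ _
  (fun n y => (h (n + r0)%N y * p y)%:E) _ (EFin \o (fun=> C))) => //=.
- move=> n; apply/measurable_EFinP; have [rpos _] := hK (n + r0)%N (leq_addl _ _).
  have [[dchi cdchi] _ _] : [/\ (forall x, derivable (chi (n + r0)%N) x 1) /\
    continuous (derive1 (chi (n + r0)%N)), True & True] by case: hchi => /(_ _ rpos).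
  have cchi : continuous (chi (n + r0)%N).
    by move=> x; apply: differentiable_continuous; apply/derivable1_diffP.
  have bd : bounded_measurable a b
      (dnetwork (chi (n + r0)%N) (derive1 (chi (n + r0)%N)) theta V).
    by apply: continuous_bounded_measurable; exact: dnetwork_continuous.
  suff [] : bounded_measurable a b (fun y => h (n + r0)%N y * p y) by [].
  apply: bounded_measurableM => //; apply: bounded_measurableM => //.
  apply: bounded_measurableM; first exact: bounded_measurable_cst.
  by apply: bounded_measurableB => //; exact: bn.
- move=> y yab; apply: cvg_EFin; first exact: nearW.
  rewrite /comp/= /h; apply: cvgM; last exact: cvg_cst.
  have shift (u : nat -> R) (l : R) :
      u n @[n --> \oo] --> l -> u (n + r0)%N @[n --> \oo] --> l.
    by rewrite cvg_shiftn.
  have c1 z : chi n z @[n --> \oo] --> relu z by case: (relu_approximation_cvg hchi z).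
  have c2 z : derive1 (chi n) z @[n --> \oo] --> heaviside z.
    by case: (relu_approximation_cvg hchi z).
  apply: (shift (fun n => 2 * (network (chi n) theta y - f y) *
    dnetwork (chi n) (derive1 (chi n)) theta V y)).
  apply: cvgM.
    apply: cvgM; first exact: cvg_cst.
    apply: cvgB; last exact: cvg_cst.
    apply: cvgD; first exact: cvg_cst.
    by apply: cvg_big_seq => j; apply: cvgM; [exact: cvg_cst|exact: c1].
  apply: cvgD; first exact: cvg_cst.
  apply: cvg_big_seq => j; apply: cvgD.
    by apply: cvgM; [exact: cvg_cst|exact: c1].
  apply: cvgM; first exact: cvg_cst.
  by apply: cvgM; [exact: c2|exact: cvg_cst].
- by apply: bounded_measurable_integrable; exact: bounded_measurable_cst.
- move=> n y yab; rewrite lee_fin.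
  have [_ /(_ 0 y)] := hK (n + r0)%N (leq_addl _ _).
  rewrite in_itv/= scale0r add0r => -[]//; first by apply/andP; split; lra.
  move=> n1 n2; apply: le_trans (ler_norm _); rewrite !normrM normr_nat.
  rewrite ler_pM ?mulr_ge0 ?hP// ler_pM ?mulr_ge0// ler_pM// .
  by rewrite (le_trans (ler_normB _ _))// lerD// hF.
Unshelve. all: by end_near. Qed.

End GradientLimit.

(** The approximate gradients converge at every parameter, even where the risk is not
    differentiable, so the condition on [G] determines it completely. *)
Lemma generalized_gradientE (R : realType) (H : nat) (a b : R) (f p : R -> R)
    (chi : nat -> R -> R) (G : 'rV[R]_(3 * H).+1 -> 'rV[R]_(3 * H).+1) :
  bounded_measurable a b f -> bounded_measurable a b p ->
  relu_approximation chi -> generalized_gradient a b f p chi G ->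
  forall theta i, G theta 0 i = wint a b p (fun y =>
    2 * (network (@relu R) theta y - f y)
    * dnetwork (@relu R) (@heaviside R) theta (delta_mx 0 i) y).
Proof.
move=> bf bp hchi hG theta i.
pose g (j : 'I_(3 * H).+1) := wint a b p (fun y => 2 * (network (@relu R) theta y - f y)
    * dnetwork (@relu R) (@heaviside R) theta (delta_mx 0 j) y).
have gi j : gradient (approx_risk a b f p (chi r)) theta 0 j @[r --> \oo] --> g j.
  by under eq_fun do rewrite mxE; exact: cvg_gradient.
have cg : gradient (approx_risk a b f p (chi r)) theta @[r --> \oo]
    --> (\row_j g j : 'rV[R]_(3 * H).+1).
  apply/cvgrPdist_lt => e e0.
  have h (j : 'I_(3 * H).+1) : \forall r \near \oo,
      `|g j - gradient (approx_risk a b f p (chi r)) theta 0 j| < e.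
    by move/cvgrPdist_lt : (gi j) => /(_ e e0).
  have hall : \forall r \near \oo, forall j : 'I_(3 * H).+1,
      `|g j - gradient (approx_risk a b f p (chi r)) theta 0 j| < e.
    exact: filter_forall.
  apply: filterS hall => r hr.
  rewrite [ltLHS]/Num.Def.normr/= mx_normrE; apply: bigmax_lt => //= -[k j] _ /=.
  by rewrite ord1 mxE [X in X + _]mxE [X in _ + X]mxE.
rewrite hG; last by apply/cvg_ex; eexists; exact: cg.
by rewrite (cvg_lim _ cg)// mxE.
Qed.

(** * Descent with summable step lengths *)

Section LocalDescent.
Variables (R : realType) (n : nat) (L : 'rV[R]_n -> R) (G : 'rV[R]_n -> 'rV[R]_n).
Variables (theta1 : 'rV[R]_n) (eps mu M C0 hmax : R).
Hypotheses (eps0 : 0 < eps) (mu0 : 0 < mu) (M0 : 0 <= M) (C00 : 0 <= C0) (hmax0 : 0 < hmax).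
Hypothesis L0 : forall theta, 0 <= L theta.
Hypothesis PL : forall theta, `|theta - theta1| < eps -> mu * L theta <= `|G theta| ^+ 2.
Hypothesis UB : forall theta, `|theta - theta1| < eps -> `|G theta| ^+ 2 <= M * L theta.
Hypothesis desc : forall theta h, 0 < h <= hmax -> `|theta - theta1| < eps ->
  `|theta - h *: G theta - theta1| < eps ->
  L (theta - h *: G theta) <= L theta - h / 2 * `|G theta| ^+ 2.
Hypothesis quad : forall theta, `|theta - theta1| < eps ->
  L theta <= C0 * `|theta - theta1| ^+ 2.

(* Dividing (s - s')(s + s') >= h g^2 / 2 by s + s' <= 2 s makes the step lengths
   h g telescope. *)
Lemma sqrt_decrease (s s' m h g : R) : 0 <= s -> 0 <= s' -> 0 < m -> 0 < h -> 0 <= g ->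
  m * s <= g -> (s = 0 -> g = 0) -> s' ^+ 2 <= s ^+ 2 - h / 2 * g ^+ 2 ->
  h * g <= 4 / m * (s - s').
Proof.
move=> s0 s'0 m0 h0 g0 msg sg ss'.
have s's : s' <= s.
  rewrite -(@ler_pXn2r _ 2) ?nnegrE//; apply: le_trans ss' _.
  by rewrite gerBl mulr_ge0 ?exprn_ge0// divr_ge0// ltW.
have [sE|sN0] := eqVneq s 0.
  by rewrite sg// mulr0 mulr_ge0 ?subr_ge0// divr_ge0// ltW.
have spos : 0 < s by rewrite lt_neqAle eq_sym sN0.
rewrite mulrAC ler_pdivlMr//.
rewrite -(ler_pM2r spos).
have h1 : (s - s') * (s + s') <= (s - s') * (2 * s).
  by rewrite ler_wpM2l ?subr_ge0//; lra.
have h2 : h * g * (m * s) <= h * g * g.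
  by rewrite ler_wpM2l// mulr_ge0// ltW.
nra.
Qed.

Lemma local_descent : exists delta : R, 0 < delta <= eps /\
  forall (h : nat -> R) (Th : nat -> 'rV[R]_n),
    `|Th 0 - theta1| < delta ->
    (forall k, 0 < h k <= hmax) ->
    (forall k, Th k.+1 = Th k - h k *: G (Th k)) ->
    forall k, L (Th k) <= C0 * eps ^+ 2 * expR (- (mu / 2 * \sum_(i < k) h i)).
Proof.
pose m := Num.sqrt mu; pose A := 4 / m; pose B := hmax * Num.sqrt M.
have m0 : 0 < m by rewrite sqrtr_gt0.
have A0 : 0 <= A by rewrite divr_ge0// ltW.
have B0 : 0 <= B by rewrite mulr_ge0 ?sqrtr_ge0// ltW.
(* Starting within [eps / K], three lengths must add up to at most [eps]: the initial distance, the
   total path length [A * sqrt L], and one further step of length at most [B * sqrt L]. By [quad],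
   [sqrt L] is at most [sqrt C0] times the initial radius. *)
pose K := 1 + (A + B) * Num.sqrt C0.
have K1 : 1 <= K by rewrite lerDl mulr_ge0 ?sqrtr_ge0// addr_ge0.
have K0 : 0 < K by rewrite (lt_le_trans ltr01).
pose delta := eps / K.
have delta0 : 0 < delta by rewrite divr_gt0.
have deltaeps : delta <= eps by rewrite ler_pdivrMr// ler_peMr// ltW.
exists delta; split; first by apply/andP.
move=> h Th Th0 hh hTh.
have hpos k : 0 < h k by case/andP: (hh k).
have Th0eps : `|Th 0%N - theta1| < eps by exact: lt_le_trans deltaeps.
have sL0 : Num.sqrt (L (Th 0%N)) <= Num.sqrt C0 * delta.
  rewrite -[delta]ger0_norm ?(ltW delta0)// -sqrtr_sqr -sqrtrM//.
  rewrite ler_wsqrtr// (le_trans (quad Th0eps))// ler_wpM2l//.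
  by rewrite lerXn2r ?nnegrE// ltW.
have near_eps r : r <= (A + B) * Num.sqrt (L (Th 0%N)) -> forall theta,
    `|theta - Th 0%N| <= r -> `|theta - theta1| < eps.
  move=> rAB theta tr; rewrite -(subrK (Th 0%N) theta) -addrA.
  rewrite (le_lt_trans (ler_normD _ _))//.
  have -> : eps = (A + B) * (Num.sqrt C0 * delta) + delta.
    have {1}-> : eps = K * delta by rewrite /delta mulrC divfK// gt_eqF.
    by rewrite /K; ring.
  rewrite ler_ltD// (le_trans tr)// (le_trans rAB)// ler_wpM2l// addr_ge0//.
(* Distance travelled plus a potential [A * sqrt L]: by [sqrt_decrease] each step pays for its
   length with a drop of the potential, which confines the whole orbit. *)
suff inv k : `|Th k - Th 0%N| + A * Num.sqrt (L (Th k)) <= A * Num.sqrt (L (Th 0%N)) /\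
    L (Th k) <= L (Th 0%N) * expR (- (mu / 2 * \sum_(i < k) h i)).
  move=> k; apply: le_trans (inv k).2 _; rewrite ler_wpM2r ?expR_ge0//.
  rewrite (le_trans (quad Th0eps))// ler_wpM2l//.
  by rewrite lerXn2r ?nnegrE// ltW.
have sq theta := sqr_sqrtr (L0 theta).
elim: k => [|k [ih1 ih2]].
  by rewrite subrr normr0 add0r big_ord0 mulr0 oppr0 expR0 mulr1.
have AL0 k' : 0 <= A * Num.sqrt (L (Th k')) by rewrite mulr_ge0 ?sqrtr_ge0.
have dk : `|Th k - Th 0%N| <= A * Num.sqrt (L (Th 0%N)) by have := AL0 k; lra.
have keps : `|Th k - theta1| < eps.
  by apply: near_eps dk; rewrite ler_wpM2r ?sqrtr_ge0// lerDl.
have Lk : L (Th k) <= L (Th 0%N).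
  apply: le_trans ih2 _; rewrite ler_piMr// -expR0 ler_expR oppr_le0.
  by rewrite mulr_ge0 ?sumr_ge0// ?divr_ge0 ?(ltW mu0)// => i _; exact: ltW.
set g := `|G (Th k)|; have g0 : 0 <= g by exact: normr_ge0.
have gM : g <= Num.sqrt M * Num.sqrt (L (Th 0%N)).
  rewrite -[g]ger0_norm// -sqrtr_sqr -sqrtrM// ler_wsqrtr// (le_trans (UB keps))//.
  by rewrite ler_wpM2l.
have stepE : Th k.+1 - Th 0%N = (Th k - Th 0%N) - h k *: G (Th k).
  by rewrite hTh addrAC.
have nstep : `|Th k.+1 - Th 0%N| <= `|Th k - Th 0%N| + h k * g.
  by rewrite stepE (le_trans (ler_normB _ _))// lerD2l normrZ gtr0_norm.
(* [desc] requires both endpoints in the ball, so a crude length bound from [UB] comes before the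
   sharp one. *)
have k1eps : `|Th k.+1 - theta1| < eps.
  apply: (near_eps ((A + B) * Num.sqrt (L (Th 0%N)))) => //.
  rewrite (le_trans nstep)// mulrDl lerD// /B -mulrA ler_pM// ?(ltW (hpos k))//.
  by case/andP: (hh k).
have dL : L (Th k.+1) <= L (Th k) - h k / 2 * g ^+ 2.
  by rewrite hTh; apply: desc => //; rewrite -hTh.
have pl : mu * L (Th k) <= g ^+ 2 by exact: PL.
split.
  have hg : h k * g <= A * (Num.sqrt (L (Th k)) - Num.sqrt (L (Th k.+1))).
    apply: sqrt_decrease => //; rewrite ?sqrtr_ge0// ?sq//.
      by rewrite -sqrtrM ?(ltW mu0)// -[leRHS]ger0_norm// -sqrtr_sqr ler_wsqrtr.
    (* At zero loss [UB] forces the gradient to vanish, so the iteration is stationary. *)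
    move=> s0; have := UB keps; rewrite -[L _]sq s0 expr0n mulr0 -/g => g2.
    by apply/eqP; rewrite -(@sqrf_eq0 R) eq_le g2 sqr_ge0.
  lra.
rewrite big_ord_recr/= mulrDr opprD expRD mulrA.
apply: (@le_trans _ _ (L (Th k) * expR (- (mu / 2 * h k)))); last first.
  by rewrite ler_wpM2r ?expR_ge0.
(* The inequality [PL] turns the decrease into this factor, and [1 + x <= expR x] gives the
   exponential. *)
apply: (@le_trans _ _ (L (Th k) * (1 + - (mu / 2 * h k)))); last first.
  by rewrite ler_wpM2l// expR_ge1Dx.
have := ler_wpM2l (ltW (hpos k)) pl; lra.
Qed.

End LocalDescent.

(** Each of the [n] summands is at least the last one, and n / n^rho = n^(1 - rho). *)
Lemma sum_step_ge (R : realType) (gamma rho : R) (n : nat) :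
  0 < gamma -> 0 <= rho < 1 ->
  gamma * n%:R `^ (1 - rho) <= \sum_(i < n) gamma / (i.+1%:R `^ rho).
Proof.
move=> g0 /andP[r0 r1]; case: n => [|n].
  (* For [n = 0] the power is 0 because its exponent is nonzero. *)
  by rewrite big_ord0 powR0 ?mulr0//; lra.
apply: (@le_trans _ _ (\sum_(i < n.+1) gamma / (n.+1%:R `^ rho))).
  rewrite sumr_const card_ord -[leRHS]mulr_natr -[leRHS]mulrA ler_wpM2l ?(ltW g0)//.
  have N0 : 0 < n.+1%:R :> R by rewrite ltr0n.
  rewrite powRB; last by rewrite gt_eqF ?implybT.
  rewrite powRr1 ?(ltW N0)//.
  by rewrite mulrC.
apply: ler_sum => i _; rewrite ler_wpM2l ?(ltW g0)// lef_pV2 ?posrE ?powR_gt0 ?ltr0n//.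
by apply: ge0_ler_powR => //; rewrite ?nnegrE ?ler0n// ler_nat ltn_ord.
Qed.

(** * Parameter vectors, linearity in the direction, and quadratic integrals *)

Section ParamVector.
Variables (R : realType) (H : nat).
Implicit Types (theta V : 'rV[R]_(3 * H).+1).

Lemma normr_rV_ub n (v : 'rV[R]_n) (K : R) :
  0 <= K -> (forall i, `|v 0 i| <= K) -> `|v| <= K.
Proof.
move=> K0 vK; rewrite [leLHS]/Num.Def.normr/= mx_normrE; apply: bigmax_le => //= -[i j] _.
by rewrite ord1 vK.
Qed.

(** Neurons are numbered from 1 and columns from 0, hence the successors. *)
Definition param (w b v : nat -> R) (c : R) : 'rV[R]_(3 * H).+1 :=
  \row_(i < (3 * H).+1)
    if (i < H)%N then w i.+1
    else if (i < 2 * H)%N then b (i - H).+1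
    else if (i < 3 * H)%N then v (i - 2 * H).+1 else c.

Lemma coord_param_w w b v c j : (0 < j <= H)%N -> coord (param w b v c) j = w j.
Proof.
move=> jH; rewrite /Defs.coord mxE inordK; last lia.
by case: ifPn => h; [congr w|]; lia.
Qed.

Lemma coord_param_b w b v c j : (0 < j <= H)%N -> coord (param w b v c) (H + j) = b j.
Proof.
move=> jH; rewrite /Defs.coord mxE inordK; last lia.
by case: ifPn => h; [lia|case: ifPn => h'; [congr b|]; lia].
Qed.

Lemma coord_param_v w b v c j : (0 < j <= H)%N -> coord (param w b v c) (2 * H + j) = v j.
Proof.
move=> jH; rewrite /Defs.coord mxE inordK; last lia.
by do 2 (case: ifPn => ?; first lia); case: ifPn => h'; [congr v|]; lia.
Qed.

Lemma coord_param_c w b v c : coord (param w b v c) (3 * H + 1) = c.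
Proof.
rewrite /Defs.coord mxE inordK; last lia.
by do 3 (case: ifPn => ?; first lia).
Qed.

Lemma normr_param_le w b v c (K : R) :
  (forall j, (0 < j <= H)%N -> [/\ `|w j| <= K, `|b j| <= K & `|v j| <= K]) ->
  `|c| <= K -> forall i, `|param w b v c 0 i| <= K.
Proof.
move=> wbv cK i; rewrite mxE; case: ifPn => h1.
  by case: (wbv i.+1) => //; lia.
case: ifPn => h2; first by case: (wbv (i - H).+1) => //; lia.
by case: ifPn => h3; first by case: (wbv (i - 2 * H).+1) => //; lia.
Qed.

Lemma dnetworkD act dact theta V1 V2 y :
  dnetwork act dact theta (V1 + V2) y
  = dnetwork act dact theta V1 y + dnetwork act dact theta V2 y.
Proof.
rewrite /dnetwork coordD addrACA -big_split/=; congr (_ + _).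
by apply: eq_bigr => j _; rewrite /neuron !coordD; ring.
Qed.

Lemma dnetworkZ act dact theta (t : R) V y :
  dnetwork act dact theta (t *: V) y = t * dnetwork act dact theta V y.
Proof.
rewrite /dnetwork coordZ mulrDr mulr_sumr; congr (_ + _).
by apply: eq_bigr => j _; rewrite /neuron !coordZ; ring.
Qed.

Lemma dnetwork_sum act dact theta V y :
  dnetwork act dact theta V y
  = \sum_i V 0 i * dnetwork act dact theta (delta_mx 0 i) y.
Proof.
rewrite {1}(row_sum_delta V).
elim/big_ind2 : _ => [|V1 x1 V2 x2 <- <-|i _]; last exact: dnetworkZ.
  by rewrite -(scale0r 0) dnetworkZ mul0r.
exact: dnetworkD.
Qed.

End ParamVector.

(** Centring at the midpoint removes the cross term, so the integral bounds the slope and the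
    midpoint value separately. *)
Lemma Rintegral_sqr_affine (R : realType) (s t m l : R) : 0 < l ->
  \int[lebesgue_measure]_(y in `[m - l, m + l]) (s * y + t) ^+ 2
  = 2 * l * ((s * m + t) ^+ 2 + s ^+ 2 * l ^+ 2 / 3).
Proof.
move=> l0.
pose P : {poly R} := (s ^+ 2 / 3) *: 'X^3 + (s * t) *: 'X^2 + (t ^+ 2) *: 'X.
have PE y : P.[y] = s ^+ 2 / 3 * y ^+ 3 + s * t * y ^+ 2 + t ^+ 2 * y.
  by rewrite !hornerE.
have dP y : (P^`()).[y] = (s * y + t) ^+ 2.
  by rewrite !derivD !derivZ !derivXn derivX !hornerE/=; field.
have cP : continuous (horner P) by exact: continuous_horner.
rewrite /Rintegral (@continuous_FTC2 _ _ (horner P)).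
- by rewrite -EFinB /= !PE; field.
- lra.
- rewrite (_ : (fun y => _) = horner P^`()); last by apply/funext => y; rewrite dP.
  by apply: continuous_subspaceT; exact: continuous_horner.
- split.
  + by move=> y _; exact: derivable_horner.
  + by apply: cvg_at_right_filter; exact: cP.
  + by apply: cvg_at_left_filter; exact: cP.
- by move=> y _; rewrite -derivE dP.
Qed.

(** This replaces the chain rule for the risk: [dnetwork] is linear in [V], so the coordinates of
    [G] determine the integral for every direction. *)
Lemma wint_dnetwork_dot (R : realType) (H : nat) (a b : R) (f p : R -> R)
    (G : 'rV[R]_(3 * H).+1) (theta V : 'rV[R]_(3 * H).+1) :
  bounded_measurable a b f -> bounded_measurable a b p ->
  (forall i, G 0 i = wint a b p (fun y =>
    2 * (network (@relu R) theta y - f y)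
    * dnetwork (@relu R) (@heaviside R) theta (delta_mx 0 i) y)) ->
  wint a b p (fun y => 2 * (network (@relu R) theta y - f y)
    * dnetwork (@relu R) (@heaviside R) theta V y) = \sum_i V 0 i * G 0 i.
Proof.
move=> bf bp hG.
have br : bounded_measurable a b (fun y => 2 * (network (@relu R) theta y - f y)).
  apply: bounded_measurableM; first exact: bounded_measurable_cst.
  by apply: bounded_measurableB => //; exact: bounded_measurable_network.
have brd i : bounded_measurable a b (fun y => 2 * (network (@relu R) theta y - f y)
    * dnetwork (@relu R) (@heaviside R) theta (delta_mx 0 i) y).
  by apply: bounded_measurableM => //; exact: bounded_measurable_dnetwork.
under eq_bigr => i _ do rewrite hG -wintZ//.
rewrite -(wint_sum bp); last first.
  by move=> i; apply: bounded_measurableM; [exact: bounded_measurable_cst|].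
apply: eq_wint => y _; rewrite dnetwork_sum mulr_sumr.
by apply: eq_bigr => i _; ring.
Qed.

(** * Analysis near a teacher network *)

Lemma normr_le_sqr (R : realType) (x k : R) : 0 <= k -> x ^+ 2 <= k ^+ 2 -> `|x| <= k.
Proof.
by move=> k0 xk; rewrite -(@ler_pXn2r _ 2) ?nnegrE// real_normK ?num_real.
Qed.

Lemma normr_heaviside_le (R : realType) (z : R) : `|heaviside z| <= 1.
Proof. by rewrite /heaviside; case: ltP => _; rewrite ?normr1 ?normr0. Qed.

Lemma normr_relu_le (R : realType) (z : R) : `|relu z| <= `|z|.
Proof. by rewrite reluE normrM ler_piMl// normr_heaviside_le. Qed.

(* On a sign mismatch between z and d, the terms v z and - beta d have the same sign. *)
Lemma sign_mismatch_le (R : realType) (beta v z d : R) : `|v - beta| < `|beta| ->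
  `|beta * d * (heaviside z - heaviside d)| <= `|v * z - beta * d|.
Proof.
move=> vb; rewrite /heaviside.
have [z0|z0] := ltP 0 z; have [d0|d0] := ltP 0 d; rewrite ?subrr ?mulr0 ?normr0//.
  rewrite subr0 mulr1; move: vb; have [b0|b0] := leP 0 beta.
    rewrite ltr_norml ger0_norm// => /andP[h1 h2].
    by rewrite ler0_norm ?mulr_ge0_le0// ger0_norm; nra.
  rewrite ltr_norml ltr0_norm// => /andP[h1 h2].
  by rewrite ger0_norm ?mulr_le0// ?(ltW b0)// ler0_norm; nra.
rewrite sub0r mulrN1 normrN; move: vb; have [b0|b0] := leP 0 beta.
  rewrite ltr_norml ger0_norm// => /andP[h1 h2].
  by rewrite ger0_norm ?mulr_ge0 ?(ltW d0)// ler0_norm; nra.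
rewrite ltr_norml ltr0_norm// => /andP[h1 h2].
by rewrite ler0_norm ?mulr_le0_ge0 ?(ltW d0) ?(ltW b0)// ger0_norm; nra.
Qed.

Lemma relu_lipschitz (R : realType) (z z' : R) : `|relu z' - relu z| <= `|z' - z|.
Proof.
rewrite /relu; case: (leP z' 0) => h'; case: (leP z 0) => h.
- by rewrite subrr normr0.
- by rewrite sub0r normrN gtr0_norm// ler0_norm; lra.
- by rewrite subr0 gtr0_norm// ger0_norm; lra.
- by [].
Qed.

(** The kink only allows a first-order bound. It is applied near knots, where smallness comes from
    the measure of the set instead. *)
Lemma relu_taylor_le (R : realType) (z z' : R) :
  `|relu z' - relu z - heaviside z * (z' - z)| <= `|z' - z|.
Proof.
rewrite !reluE /heaviside; case: (ltP 0 z') => h'; case: (ltP 0 z) => h;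
  rewrite ?mul1r ?mul0r ?subrr ?subr0 ?normr0 ?sub0r//.
- by rewrite gtr0_norm// ger0_norm; lra.
- by rewrite (_ : _ - _ = - z'); [rewrite normrN ler0_norm// ler0_norm; lra|ring].
Qed.

(** A step along [- G] gains the Euclidean square of [G], whereas the descent estimate is stated in
    the maximum norm. *)
Lemma sqr_normr_le_sum (R : realType) (n : nat) (v : 'rV[R]_n) :
  `|v| ^+ 2 <= \sum_i v 0 i ^+ 2.
Proof.
have s0 : 0 <= \sum_i v 0 i ^+ 2 by apply: sumr_ge0 => i _; exact: sqr_ge0.
rewrite -(sqr_sqrtr s0) lerXn2r ?nnegrE ?sqrtr_ge0//.
apply: normr_rV_ub => [|i]; first exact: sqrtr_ge0.
by rewrite -sqrtr_sqr ler_wsqrtr// (bigD1 i)//= lerDl sumr_ge0// => j _; exact: sqr_ge0.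
Qed.

Section LocalAnalysis.
Variables (R : realType) (H N : nat) (a b : R) (f p : R -> R).
Variables (G : 'rV[R]_(3 * H).+1 -> 'rV[R]_(3 * H).+1).
Variables (xi beta mid : nat -> R) (c1 D lam pm P beta0 : R).

(* The target is the network with neurons relu (y - xi j), output weights beta j and
   output bias c1. The interval of radius lam around mid i lies in the i-th affine
   piece at distance at least lam from every knot, so near the teacher the residual
   is affine on it. *)
Record setting : Prop := Setting {
  st_ab : a < b;
  st_HN : (0 < N <= H)%N;
  st_bf : bounded_measurable a b f;
  st_bp : bounded_measurable a b p;
  st_pm0 : 0 < pm;
  st_p_bounds : forall y, y \in `[a, b] -> pm <= p y <= P;
  st_hG : forall theta i, G theta 0 i = wint a b p (fun y =>
      2 * (network (@relu R) theta y - f y)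
      * dnetwork (@relu R) (@heaviside R) theta (delta_mx 0 i) y);
  st_fE : forall y, y \in `[a, b] ->
    f y = c1 + \sum_(1 <= j < H.+1) beta j * relu (y - xi j);
  st_D_ab : `|a| + `|b| + 2 <= D;
  st_beta_le : forall j, `|beta j| <= D - 1;
  st_c1_le : `|c1| <= D - 1;
  st_xi_le : forall j, `|xi j| <= D - 1;
  st_xi_dist : forall j y, (0 < j <= N)%N -> y \in `[a, b] -> `|y - xi j| <= D - 1;
  st_xi_first : forall y, y \in `[a, b] -> xi 1 + 1 <= y;
  st_xi_last : forall j y, (N < j)%N -> y \in `[a, b] -> y + 1 <= xi j;
  st_beta_last : forall j, (N < j)%N -> beta j = 0;
  st_lam01 : 0 < lam <= 1;
  st_midP : forall i y, (0 < i <= N)%N -> `|y - mid i| <= lam ->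
    [/\ y \in `[a, b], forall j, (0 < j <= i)%N -> xi j + lam <= y
      & forall j, (i < j)%N -> y + lam <= xi j];
  st_beta0_gt0 : 0 < beta0;
  st_beta0P : forall j, beta j != 0 -> beta0 <= `|beta j| }.

Hypothesis st : setting.
Local Notation ab := (st_ab st).
Local Notation HN := (st_HN st).
Local Notation bf := (st_bf st).
Local Notation bp := (st_bp st).
Local Notation pm0 := (st_pm0 st).
Local Notation p_bounds := (st_p_bounds st).
Local Notation hG := (st_hG st).
Local Notation fE := (st_fE st).
Local Notation D_ab := (st_D_ab st).
Local Notation beta_le := (st_beta_le st).
Local Notation c1_le := (st_c1_le st).
Local Notation xi_le := (st_xi_le st).
Local Notation xi_dist := (st_xi_dist st).
Local Notation xi_first := (st_xi_first st).
Local Notation xi_last := (st_xi_last st).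
Local Notation beta_last := (st_beta_last st).
Local Notation lam01 := (st_lam01 st).
Local Notation midP := (st_midP st).
Local Notation beta0_gt0 := (st_beta0_gt0 st).
Local Notation beta0P := (st_beta0P st).

Implicit Types theta V : 'rV[R]_(3 * H).+1.
Local Notation mu := (@lebesgue_measure R).
Local Notation net := (network (@relu R)).
Local Notation dnet := (dnetwork (@relu R) (@heaviside R)).
Local Notation wi := (wint a b p).

Definition teacher : 'rV[R]_(3 * H).+1 := param H (fun=> 1) (fun j => - xi j) beta c1.
Definition residual theta y := net theta y - f y.
Definition loss theta := wi (fun y => residual theta y ^+ 2).

Lemma lam_gt0 : 0 < lam. Proof. by case/andP: lam01. Qed.
Lemma lam_le1 : lam <= 1. Proof. by case/andP: lam01. Qed.

Lemma norm_le_D y : y \in `[a, b] -> `|y| + 1 <= D - 1.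
Proof.
rewrite in_itv/= => /andP[ay yb]; suff : `|y| <= `|a| + `|b| by move: D_ab; lra.
rewrite ler_norml; have := ler_norm b; have := ler_norm (- a); rewrite normrN.
have := normr_ge0 a; have := normr_ge0 b; move: ay yb; lra.
Qed.

Lemma first_index : (0 < 1 <= H)%N.
Proof. by case/andP: HN => N0 NH; rewrite /= (leq_trans N0 NH). Qed.

Lemma D_ge2 : 2 <= D.
Proof. by have := normr_ge0 a; have := normr_ge0 b; move: D_ab; lra. Qed.

Lemma p_ge0 y : y \in `[a, b] -> 0 <= p y.
Proof. by move=> /p_bounds/andP[h _]; rewrite (le_trans _ h)// (ltW pm0). Qed.

Lemma p_le y : y \in `[a, b] -> p y <= P.
Proof. by case/p_bounds/andP. Qed.

Lemma a_in : a \in `[a, b]. Proof. by rewrite in_itv/= lexx (ltW ab). Qed.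

Lemma P_gt0 : 0 < P.
Proof. by have /andP[h1 h2] := p_bounds a_in; apply: lt_le_trans pm0 (le_trans h1 h2). Qed.

Lemma bounded_measurable_residual theta : bounded_measurable a b (residual theta).
Proof. by apply: bounded_measurableB bf; exact: bounded_measurable_network. Qed.

Lemma loss_ge0 theta : 0 <= loss theta.
Proof. by apply: wint_ge0 p_ge0 _ _ => y _; exact: sqr_ge0. Qed.

Local Notation sigma theta := (Num.sqrt (loss theta)).

Lemma sqr_sigma theta : sigma theta ^+ 2 = loss theta.
Proof. by rewrite sqr_sqrtr// loss_ge0. Qed.

Lemma sigma_ge0 theta : 0 <= sigma theta. Proof. exact: sqrtr_ge0. Qed.

(** Each constant multiplies [sigma] in one estimate. [slope_const] inverts the quadratic form on
    the bulk of a piece; [gap_const] pays for the difference of two pieces; in [lift_const] the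
    summands come from dividing by [v j], from dividing by [w j >= 1 / 2], and from the output bias.
    The factor in [gradient_const] is the number of parameters. None of them depends on [eta] or
    [eps]. *)
Definition slope_const := 1 + 3 / (2 * pm * lam ^+ 3).
Definition gap_const := 2 * (D * slope_const).
Definition lift_const := gap_const * (2 / beta0 + 2 + (1 + 2 * D)).
Definition feature_const := 1 + 2 * H%:R * D ^+ 2.
Definition residual_const := feature_const * lift_const + H%:R * (gap_const * D).
Definition gradient_const := (3 * H).+1%:R * lift_const.

Local Notation K1 := slope_const.
Local Notation K3 := gap_const.
Local Notation Ku := lift_const.
Local Notation K6 := feature_const.
Local Notation K5 := residual_const.
Local Notation Kp := gradient_const.

Lemma slope_const_ge1 : 1 <= K1.
Proof. by rewrite lerDl divr_ge0// !mulr_ge0// ?exprn_ge0// ltW ?pm0 ?lam_gt0. Qed.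

Lemma gap_const_gt0 : 0 < K3.
Proof.
have := slope_const_ge1; have := D_ge2 => h1 h2.
by rewrite /gap_const !mulr_gt0//; lra.
Qed.

Lemma lift_const_gt0 : 0 < Ku.
Proof.
have := D_ge2 => h; have h0 : 0 < 2 / beta0 by rewrite divr_gt0// beta0_gt0.
by rewrite /lift_const mulr_gt0 ?gap_const_gt0//; lra.
Qed.

Lemma feature_const_ge1 : 1 <= K6.
Proof. by rewrite /feature_const lerDl mulr_ge0 ?sqr_ge0// mulr_ge0. Qed.

Lemma residual_const_gt0 : 0 < K5.
Proof.
have h1 := lift_const_gt0; have h2 := gap_const_gt0; have h3 := feature_const_ge1; have h4 := D_ge2.
have h5 : 0 < K6 * Ku by rewrite mulr_gt0//; lra.
have h6 : 0 <= H%:R * (K3 * D) by rewrite mulr_ge0// mulr_ge0//; lra.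
by rewrite /residual_const; lra.
Qed.

Lemma gradient_const_gt0 : 0 < Kp.
Proof. by rewrite mulr_gt0 ?lift_const_gt0// ltr0n. Qed.

Lemma ba_le : b - a <= D.
Proof.
have := ler_norm b; have := ler_norm (- a); rewrite normrN.
by have := D_ab; have := normr_ge0 a; have := normr_ge0 b; lra.
Qed.

Section Near.
Variables (eta eps : R).
(** Outside the [eta]-neighbourhoods of the knots, every parameter within [eps] of the teacher has
    the teacher's activations. The last three conditions absorb, in order, the kink part of the
    gradient inequality and the near-knot and product parts of the descent remainder. *)
Record radii : Prop := Radii {
  rd_eta_lam : 0 < eta <= lam;
  rd_eps_half : 0 < eps <= 1 / 2;
  rd_eps_eta : eps * D <= eta;
  rd_eps_beta : eps <= beta0 / 2;
  rd_eta_small : 4 * H%:R * K5 * K3 * D * P * eta <= 1;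
  rd_eta_desc : 32 * K5 * Kp * D ^+ 2 * H%:R * P * eta <= 1;
  rd_eps_desc : 32 * K5 * Kp * H%:R * D * P * (b - a) * eps <= 1 }.

Hypothesis rd : radii.
Local Notation eta_lam := (rd_eta_lam rd).
Local Notation eps_half := (rd_eps_half rd).
Local Notation eps_eta := (rd_eps_eta rd).
Local Notation eps_beta := (rd_eps_beta rd).
Local Notation eta_small := (rd_eta_small rd).
Local Notation eta_desc := (rd_eta_desc rd).
Local Notation eps_desc := (rd_eps_desc rd).

Lemma eta_gt0 : 0 < eta. Proof. by case/andP: eta_lam. Qed.
Lemma eta_le1 : eta <= 1. Proof. by case/andP: eta_lam => _ h; exact: le_trans lam_le1. Qed.
Lemma eps_gt0 : 0 < eps. Proof. by case/andP: eps_half. Qed.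
Lemma eps_le_half : eps <= 1 / 2. Proof. by case/andP: eps_half. Qed.

Definition near_teacher theta := `|theta - teacher| < eps.

(** * Size of the residual at a parameter near the teacher *)

Section Fixed.
Variable theta : 'rV[R]_(3 * H).+1.
Hypothesis nt : near_teacher theta.
Local Notation w j := (coord theta j).
Local Notation bb j := (coord theta (H + j)).
Local Notation v j := (coord theta (2 * H + j)).
Local Notation cc := (coord theta (3 * H + 1)).
Local Notation act j y := (heaviside (neuron theta j y)).

Lemma near_coord k : `|coord theta k - coord teacher k| < eps.
Proof.
apply: le_lt_trans nt; rewrite (_ : _ - _ = coord (theta - teacher) k).
  exact: normr_coord_le.
by rewrite /Defs.coord !mxE.
Qed.

Lemma near_w j : (0 < j <= H)%N -> `|w j - 1| < eps.
Proof. by move=> jH; have := near_coord j; rewrite coord_param_w. Qed.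

Lemma near_b j : (0 < j <= H)%N -> `|bb j + xi j| < eps.
Proof. by move=> jH; have := near_coord (H + j); rewrite coord_param_b// opprK. Qed.

Lemma near_v j : (0 < j <= H)%N -> `|v j - beta j| < eps.
Proof. by move=> jH; have := near_coord (2 * H + j); rewrite coord_param_v. Qed.

Lemma near_neuron j y : (0 < j <= H)%N -> y \in `[a, b] ->
  `|neuron theta j y - (y - xi j)| < eta.
Proof.
move=> jH yab; rewrite (_ : _ - _ = (w j - 1) * y + (bb j + xi j)); last first.
  by rewrite /neuron; ring.
have yD := norm_le_D yab; have wj := near_w jH; have bj := near_b jH.
rewrite (le_lt_trans (ler_normD _ _))// normrM.
have : `|w j - 1| * `|y| <= eps * `|y| by rewrite ler_wpM2r// ltW.
have : eps * (`|y| + 1) <= eps * (D - 1) by rewrite (ler_wpM2l (ltW eps_gt0)).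
move: (eps_eta) (eps_gt0) bj; lra.
Qed.

Lemma heaviside_far j y : (0 < j <= H)%N -> y \in `[a, b] -> eta <= `|y - xi j| ->
  act j y = heaviside (y - xi j).
Proof.
move=> jH yab; have := near_neuron jH yab; rewrite ltr_norml => /andP[h1 h2] far.
rewrite /heaviside; congr (nat_of_bool _)%:R; move: far.
have [h|h] := leP 0 (y - xi j).
  rewrite ger0_norm// => far; apply/idP/idP => _; move: eta_gt0 h1 h2 h far; lra.
by rewrite ltr0_norm// => far; apply/idP/idP => h'; move: eta_gt0 h1 h2 h far h'; lra.
Qed.

Lemma heaviside_first y : y \in `[a, b] -> act 1 y = 1.
Proof.
move=> yab; have h := xi_first yab; rewrite heaviside_far//; last first.
by rewrite ger0_norm; move: eta_le1 h; lra.
  exact: first_index.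
by rewrite /heaviside (_ : (0 < _)%R = true)//; apply/idP; move: h; lra.
Qed.

Lemma heaviside_last j y : (N < j <= H)%N -> y \in `[a, b] -> act j y = 0.
Proof.
move=> /andP[Nj jH] yab; have h := xi_last Nj yab; rewrite heaviside_far//; last first.
- by rewrite ltr0_norm; move: eta_le1 h; lra.
- by rewrite jH (leq_ltn_trans _ Nj).
by rewrite /heaviside (_ : (0 < _)%R = false)//; apply/negP; move: h; lra.
Qed.

(** With [bias_gap] these are the coefficients of the affine function [v j * neuron theta j y - beta
    j * (y - xi j)], the difference of the weighted pre-activations. *)
Definition slope_gap j := v j * w j - beta j.
Definition bias_gap j := v j * bb j + beta j * xi j.
Definition kink_error j y := beta j * (y - xi j) * (act j y - heaviside (y - xi j)).
Local Notation S := slope_gap.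
Local Notation T := bias_gap.

(** Each summand is split by adding and subtracting the teacher's pre-activation gated by the
    activation of [theta]. *)
Lemma residual_decomp y : y \in `[a, b] ->
  residual theta y = (cc - c1) + \sum_(1 <= j < H.+1) act j y * (S j * y + T j)
    + \sum_(1 <= j < H.+1) kink_error j y.
Proof.
move=> yab; rewrite /residual /network fE// -[RHS]addrA -big_split/= opprD addrACA -sumrB.
congr (_ + _); apply: eq_bigr => j _.
by rewrite /S /T /kink_error !reluE /neuron; ring.
Qed.

Lemma kink_error_far j y : (0 < j <= H)%N -> y \in `[a, b] -> eta <= `|y - xi j| ->
  kink_error j y = 0.
Proof. by move=> jH yab far; rewrite /kink_error heaviside_far// subrr mulr0. Qed.

(** On the bulk of piece [i] exactly the neurons 1 to [i] are active. *)
Definition piece_slope i := \sum_(1 <= j < i.+1) S j.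
Definition piece_bias i := cc - c1 + \sum_(1 <= j < i.+1) T j.

Lemma residual_piece i y : (0 < i <= N)%N -> `|y - mid i| <= lam ->
  residual theta y = piece_slope i * y + piece_bias i.
Proof.
move=> iN yi; have [yab left right] := midP iN yi.
have eta_le : eta <= lam by case/andP: eta_lam.
have farl j : (0 < j <= i)%N -> eta <= `|y - xi j|.
  by move=> /left h; rewrite ger0_norm; move: lam_gt0 eta_le h; lra.
have farr j : (i < j)%N -> eta <= `|y - xi j|.
  by move=> /right h; rewrite ltr0_norm; move: lam_gt0 eta_le h; lra.
have far j : (0 < j <= H)%N -> eta <= `|y - xi j|.
  by move=> /andP[j0 _]; have [ji|ij] := leqP j i; [apply: farl; rewrite j0|exact: farr].
have iH : (i <= H)%N by case/andP: iN => _ h; case/andP: HN => _; exact: leq_trans.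
rewrite residual_decomp// [X in _ + X]big_nat_cond [X in _ + X]big1 ?addr0; last first.
  by move=> j; rewrite andbT => jH; apply: kink_error_far => //; exact: far.
rewrite (@big_cat_nat _ _ _ i.+1)//=.
rewrite [X in _ + (_ + X)]big_nat_cond [X in _ + (_ + X)]big1 ?addr0; last first.
  move=> j; rewrite andbT => /andP[ij jH].
  rewrite heaviside_far//; last exact: farr.
    rewrite /heaviside (_ : (0 < _)%R = false) ?mul0r//; apply/negP.
    by have := right j ij; move: lam_gt0; lra.
  by apply/andP; split => //; exact: leq_trans ij.
rewrite /piece_slope /piece_bias mulr_suml addrCA -big_split/=; congr (_ + _).
apply: eq_big_nat => j /andP[j0 ji].
rewrite heaviside_far//; last 2 first.
- by rewrite j0/= (leq_trans _ iH).
- by apply: farl; rewrite j0.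
rewrite /heaviside (_ : (0 < _)%R = true) ?mul1r//; apply/idP.
by have := left j; rewrite j0 => /(_ ji); move: lam_gt0; lra.
Qed.

Lemma loss_ge_piece i : (0 < i <= N)%N ->
  2 * pm * lam * ((piece_slope i * mid i + piece_bias i) ^+ 2
                  + piece_slope i ^+ 2 * lam ^+ 2 / 3) <= loss theta.
Proof.
move=> iN.
have JE y : y \in `[mid i - lam, mid i + lam] -> `|y - mid i| <= lam.
  by rewrite in_itv/= ler_distl.
have Jab : `[mid i - lam, mid i + lam]%classic `<=` `[a, b]%classic.
  by move=> y /JE/(midP iN)[].
have br2 : bounded_measurable a b (fun y => residual theta y ^+ 2 * p y).
  apply: bounded_measurableM; last exact: bp.
  by apply: bounded_measurableX; exact: bounded_measurable_residual.
have int2 := bounded_measurable_integrable br2.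
have bl2 : bounded_measurable (mid i - lam) (mid i + lam)
    (fun y => (piece_slope i * y + piece_bias i) ^+ 2).
  apply: bounded_measurableX; apply: bounded_measurableD; last exact: bounded_measurable_cst.
  apply: bounded_measurableM; first exact: bounded_measurable_cst.
  by apply: continuous_bounded_measurable => y; exact: cvg_id.
set J := `[mid i - lam, mid i + lam]%classic in Jab *.
have mJ : measurable J by exact: measurable_itv.
rewrite (_ : 2 * pm * lam * _ = \int[mu]_(y in J)
    (pm * (piece_slope i * y + piece_bias i) ^+ 2)); last first.
  rewrite RintegralZl//; first by rewrite (Rintegral_sqr_affine _ _ _ lam_gt0); ring.
  exact: bounded_measurable_integrable bl2.
apply: (@le_trans _ _ (\int[mu]_(y in J) (residual theta y ^+ 2 * p y))).
  apply: le_Rintegral => //.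
  - apply: bounded_measurable_integrable; apply: bounded_measurableM bl2.
    exact: bounded_measurable_cst.
  - exact: integrableS int2.
  move=> y yJ; rewrite -(residual_piece iN (JE _ yJ)) mulrC ler_wpM2l ?sqr_ge0//.
  by have /p_bounds/andP[] := Jab _ yJ.
have int2J : mu.-integrable J (EFin \o (fun y => residual theta y ^+ 2 * p y)).
  exact: integrableS int2.
rewrite /loss /wint /Rintegral fine_le//; try exact: integrable_fin_num.
apply: ge0_subset_integral => //.
  by case/integrableP: int2.
by move=> y yab; rewrite lee_fin mulr_ge0 ?sqr_ge0// p_ge0.
Qed.

Local Notation sg := (sigma theta).

Lemma piece_le i : (0 < i <= N)%N ->
  `|piece_slope i| <= D * K1 * sg /\ `|piece_bias i| <= D * K1 * sg.
Proof.
move=> iN.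
have h : 2 * pm * lam * ((piece_slope i * mid i + piece_bias i) ^+ 2
                  + piece_slope i ^+ 2 * lam ^+ 2 / 3) <= sg ^+ 2.
  by rewrite sqr_sigma loss_ge_piece.
move: h; set s := piece_slope i; set t := piece_bias i; set q := 2 * pm * lam ^+ 3.
have sg0 := sigma_ge0 theta; have k1 := slope_const_ge1; have d2 := D_ge2.
have q0 : 0 < q by rewrite !mulr_gt0 ?exprn_gt0 ?lam_gt0 ?pm0.
have k1sg : 0 <= K1 * sg by rewrite mulr_ge0//; lra.
have qK : 3 <= q * K1 ^+ 2.
  have qK1 : 3 <= q * K1.
    rewrite /slope_const -/q mulrDr mulr1 mulrC divfK ?gt_eqF//.
    by rewrite lerDr ltW.
  apply: le_trans qK1 _; rewrite ler_wpM2l ?(ltW q0)// expr2 ler_peMl//; lra.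
have lam2 : lam ^+ 2 <= 1 by rewrite exprn_ile1 ?lam_le1// ltW// lam_gt0.
move=> h.
have c0 : 0 <= 2 * pm * lam by rewrite mulr_ge0 ?(ltW lam_gt0)// mulr_ge0// ltW// pm0.
have hs : q * s ^+ 2 <= 3 * sg ^+ 2.
  have : 0 <= 2 * pm * lam * (s * mid i + t) ^+ 2 by rewrite mulr_ge0 ?sqr_ge0.
  move: h; rewrite /q; nra.
(* Weakening [lam] to [lam ^+ 3], possible as [lam <= 1], lets the slope and the midpoint value
   share one constant. *)
have ht : q * (s * mid i + t) ^+ 2 <= 3 * sg ^+ 2.
  have e1 : q * (s * mid i + t) ^+ 2 <= 2 * pm * lam * (s * mid i + t) ^+ 2.
    rewrite ler_wpM2r ?sqr_ge0// /q exprS mulrA -[leRHS]mulr1 ler_wpM2l//.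
  have e2 : 0 <= 2 * pm * lam * (s ^+ 2 * lam ^+ 2 / 3).
    by rewrite mulr_ge0// mulr_ge0// mulr_ge0 ?sqr_ge0.
  have := sqr_ge0 sg; move: h e1 e2; rewrite mulrDr; lra.
have bound x : q * x ^+ 2 <= 3 * sg ^+ 2 -> `|x| <= K1 * sg.
  move=> hx; apply: normr_le_sqr => //; rewrite exprMn.
  rewrite -(ler_pM2l q0) (le_trans hx)// [leRHS]mulrA ler_wpM2r ?sqr_ge0//.
have bs := bound _ hs; have bt := bound _ ht.
have mm : `|mid i - mid i| <= lam by rewrite subrr normr0 (ltW lam_gt0).
have [mab _ _] := midP iN mm; have mD := norm_le_D mab.
have e1 : K1 * sg <= D * K1 * sg by rewrite -mulrA ler_peMl//; lra.
split; first exact: le_trans bs e1.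
(* The intercept is recovered from the midpoint value; [|mid i| <= D - 2] produces the factor
   [D]. *)
rewrite (_ : t = (s * mid i + t) - s * mid i); last by ring.
rewrite (le_trans (ler_normB _ _))// normrM.
have e2 : `|s| * `|mid i| <= K1 * sg * (D - 2) by rewrite ler_pM//; lra.
move: k1sg bt e2; rewrite -mulrA; nra.
Qed.

(** The first neuron is active everywhere, so its bias gap and the output bias are visible only
    through their sum. *)
Lemma gap_first : `|S 1| <= K3 * sg /\ `|cc - c1 + T 1| <= K3 * sg.
Proof.
have N1 : (0 < 1 <= N)%N by case/andP: HN.
have [] := piece_le N1; rewrite /piece_slope /piece_bias !big_nat1 => h1 h2.
have sg0 := sigma_ge0 theta.
by rewrite /gap_const; split; move: h1 h2 (normr_ge0 (S 1)) (normr_ge0 (cc - c1 + T 1)); lra.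
Qed.

(** Passing from one piece to the next activates exactly one more neuron. *)
Lemma gap_le j : (1 < j <= N)%N -> `|S j| <= K3 * sg /\ `|T j| <= K3 * sg.
Proof.
case: j => // j /andP[j0 jN].
have [s1 t1] : `|piece_slope j| <= D * K1 * sg /\ `|piece_bias j| <= D * K1 * sg.
  by apply: piece_le; apply/andP; split; [exact: j0|exact: ltnW].
have [s2 t2] : `|piece_slope j.+1| <= D * K1 * sg /\ `|piece_bias j.+1| <= D * K1 * sg.
  exact: piece_le.
have -> : S j.+1 = piece_slope j.+1 - piece_slope j.
  by rewrite /piece_slope [\sum_(1 <= _ < j.+2) _]big_nat_recr//=; ring.
have -> : T j.+1 = piece_bias j.+1 - piece_bias j.
  by rewrite /piece_bias [\sum_(1 <= _ < j.+2) _]big_nat_recr//=; ring.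
split; rewrite (le_trans (ler_normB _ _))// /gap_const.
  by move: s1 s2; lra.
by move: t1 t2; lra.
Qed.

(* Up to the kink errors, the residual is the derivative of the network in this
   direction. If beta j != 0, the output weight v j is bounded away from 0 and the j-th
   affine increment is produced by moving the inner parameters; if beta j = 0, that
   increment is a multiple of the feature itself and v j is moved instead. *)
Definition lift_direction : 'rV[R]_(3 * H).+1 :=
  param H (fun j => if (1 < j <= N)%N && (beta j != 0) then S j / v j else 0)
          (fun j => if (1 < j <= N)%N && (beta j != 0) then T j / v j else 0)
          (fun j => if j == 1%N then S 1 / w 1
                    else if (j <= N)%N && (beta j == 0) then v j else 0)
          (cc - c1 + T 1 - S 1 / w 1 * bb 1).

Lemma near_w_ge j : (0 < j <= H)%N -> 1 / 2 <= w j.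
Proof.
by move=> /near_w; rewrite ltr_norml => /andP[h1 h2]; move: h1 h2 (eps_le_half); lra.
Qed.

Lemma near_v_ge j : (0 < j <= H)%N -> beta j != 0 -> beta0 / 2 <= `|v j|.
Proof.
move=> /near_v h /beta0P hb; have := ler_normB (v j) (v j - beta j).
rewrite opprB addrC subrK; move: h hb (eps_beta); lra.
Qed.

Lemma dnetwork_lift y : y \in `[a, b] ->
  dnet theta lift_direction y
  = cc - c1 + \sum_(1 <= j < H.+1) act j y * (S j * y + T j).
Proof.
move=> yab; have first_in := first_index; have /andP[_ HN'] := HN.
rewrite /dnetwork coord_param_c !(@big_ltn _ _ _ 1 H.+1)//.
rewrite !addrA; congr (_ + _).
  (* The first neuron, always active, supplies the linear part [S 1 * y]; the bias entry of the
     direction cancels the constant this adds. *)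
  rewrite coord_param_v//= reluE heaviside_first// /neuron coord_param_w// coord_param_b//=.
  have w1 : w 1 != 0 by rewrite gt_eqF//; have := near_w_ge first_in; lra.
  by field.
apply: eq_big_nat => j /andP[j1 jH]; have jH' : (0 < j <= H)%N by rewrite (ltnW j1).
rewrite coord_param_v// [neuron lift_direction _ _]/neuron coord_param_w// coord_param_b//.
rewrite reluE; have [jN|Nj] := leqP j N; last first.
  by rewrite heaviside_last ?Nj//; ring.
rewrite j1/= gtn_eqF//=; have [b0|b0] := eqVneq (beta j) 0.
  by rewrite /slope_gap /bias_gap /neuron b0/=; ring.
have v0 : v j != 0.
  by rewrite -normr_gt0 (lt_le_trans _ (near_v_ge jH' b0))// divr_gt0// beta0_gt0.
by rewrite /=; field.
Qed.

Lemma lift_direction_le i : `|lift_direction 0 i| <= Ku * sg.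
Proof.
have sg0 := sigma_ge0 theta; have k3 := gap_const_gt0; have d2 := D_ge2.
have ks : 0 <= K3 * sg by rewrite mulr_ge0// ltW.
have b0 : 0 < 2 / beta0 by rewrite divr_gt0// beta0_gt0.
have first_in := first_index; have /andP[_ HN'] := HN.
have [s1 t1] := gap_first.
have KuE : Ku * sg = K3 * sg * (2 / beta0) + K3 * sg * 2 + (K3 * sg + 2 * (K3 * sg) * D).
  by rewrite /lift_const; ring.
have p1 : 0 <= K3 * sg * (2 / beta0) by rewrite mulr_ge0// ltW.
have D0 : 0 <= D by lra.
have p2 : 0 <= 2 * (K3 * sg) * D by rewrite mulr_ge0// mulr_ge0.
have sw : `|S 1 / w 1| <= 2 * (K3 * sg).
  have hw := near_w_ge first_in; rewrite normrM normfV ler_pdivrMr; last by rewrite gtr0_norm; lra.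
  by rewrite [`|w 1|]gtr0_norm; nra.
have quo j x : (1 < j <= N)%N -> beta j != 0 -> `|x| <= K3 * sg ->
    `|x / v j| <= K3 * sg * (2 / beta0).
  move=> /andP[j1 jN] bj hx; have jH : (0 < j <= H)%N.
    by rewrite (ltnW j1) (leq_trans jN).
  rewrite normrM normfV ler_pM// -[leRHS]invf_div lef_pV2 ?posrE; last 2 first.
  - by rewrite (lt_le_trans _ (near_v_ge jH bj))// divr_gt0// beta0_gt0.
  - by rewrite divr_gt0// beta0_gt0.
  exact: near_v_ge.
apply: normr_param_le => [j jH|].
  have /andP[j0 _] := jH; rewrite KuE; split.
  - case: ifPn => [/andP[jN bj]|_]; last by rewrite normr0; lra.
    by have := quo j (S j) jN bj (gap_le jN).1; lra.
  - case: ifPn => [/andP[jN bj]|_]; last by rewrite normr0; lra.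
    by have := quo j (T j) jN bj (gap_le jN).2; lra.
  - case: eqP => [_|/eqP jn1]; first by lra.
    case: ifPn => [/andP[jN /eqP bj]|_]; last by rewrite normr0; lra.
    have j1 : (1 < j <= N)%N by rewrite jN andbT ltn_neqAle eq_sym jn1.
    have := (gap_le j1).1; rewrite /slope_gap bj subr0 normrM.
    have hw := near_w_ge jH; rewrite [`|w j|]gtr0_norm; last by lra.
    by have := normr_ge0 (v j); nra.
have bD : `|bb 1| <= D.
  have := near_b first_in; have := xi_le 1; have := ler_normB (bb 1 + xi 1) (xi 1).
  by rewrite addrK; have := eps_le_half; lra.
rewrite KuE (le_trans (ler_normB _ _))// normrM.
have : `|S 1 / w 1| * `|bb 1| <= 2 * (K3 * sg) * D by rewrite ler_pM.
by lra.
Qed.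

(** A nonzero error means a sign mismatch, so [sign_mismatch_le] bounds it by [S j * y + T j], which
    is of order [sigma]. The first neuron has no mismatch on the segment, so [gap_le] covers all
    remaining cases. *)
Lemma kink_error_le j y : (0 < j <= H)%N -> y \in `[a, b] ->
  `|kink_error j y| <= K3 * D * sg * ((`|y - xi j| < eta)%R)%:R.
Proof.
move=> jH yab; have [near|far] := ltP; last by rewrite kink_error_far// normr0 mulr0.
rewrite mulr1; have sg0 := sigma_ge0 theta; have k3 := gap_const_gt0; have d2 := D_ge2.
have D0 : 0 <= D by lra.
have rhs0 : 0 <= K3 * D * sg by rewrite mulr_ge0// mulr_ge0// ltW.
have [b0|b0] := eqVneq (beta j) 0; first by rewrite /kink_error b0 !mul0r normr0.
have jN : (j <= N)%N by rewrite leqNgt; apply: contra_neqN b0 => /beta_last.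
have [j1|jn1] := eqVneq j 1%N.
  rewrite /kink_error j1 heaviside_first// /heaviside (_ : (0 < _)%R = true); last first.
    by apply/idP; have := xi_first yab; lra.
  by rewrite subrr mulr0 normr0.
have j1 : (1 < j <= N)%N.
  by rewrite jN andbT ltn_neqAle eq_sym jn1; case/andP: jH.
have [sj tj] := gap_le j1.
have vb : `|v j - beta j| < `|beta j|.
  by have := near_v jH; have := beta0P b0; have := eps_beta; have := beta0_gt0; lra.
apply: le_trans (sign_mismatch_le (neuron theta j y) (y - xi j) vb) _.
rewrite (_ : _ - _ = S j * y + T j); last by rewrite /slope_gap /bias_gap /neuron; ring.
rewrite (le_trans (ler_normD _ _))// normrM.
have yD := norm_le_D yab.
have e1 : `|S j| * `|y| <= K3 * sg * (D - 2) by rewrite ler_pM//; lra.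
have e2 : 0 <= K3 * sg by rewrite mulr_ge0// ltW.
move: e1 e2 tj; lra.
Qed.

Lemma near_norm_le : `|theta| <= D.
Proof.
have h : `|teacher| <= D - 1.
  apply: normr_rV_ub => [|i]; first by have := D_ge2; lra.
  apply: normr_param_le => [j jH|]; last exact: c1_le.
  by rewrite normr1 normrN; split; [have := D_ge2; lra|exact: xi_le|exact: beta_le].
have := ler_normD (theta - teacher) teacher; rewrite subrK.
have := nt; rewrite /near_teacher; have := eps_le_half; lra.
Qed.

Lemma near_neuron_le V j y : y \in `[a, b] -> `|neuron V j y| <= `|V| * D.
Proof.
move=> yab; apply: le_trans (normr_neuron_le j (lexx _) yab) _.
by rewrite ler_wpM2l//; have := D_ab; lra.
Qed.

Lemma dnetwork_le V y : y \in `[a, b] -> `|dnet theta V y| <= K6 * `|V|.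
Proof.
move=> yab; have tD := near_norm_le; have d2 := D_ge2.
rewrite /feature_const mulrDl mul1r (le_trans (ler_normD _ _))// lerD ?normr_coord_le//.
rewrite (le_trans (ler_norm_sum _ _ _))//.
apply: (@le_trans _ _ (\sum_(1 <= j < H.+1) (2 * D ^+ 2 * `|V|))); last first.
  by rewrite sumr_const_nat subn1/= -mulr_natl; lra.
apply: ler_sum => j _; rewrite (le_trans (ler_normD _ _))// !normrM.
have e1 : `|coord V (2 * H + j)| * `|relu (neuron theta j y)| <= `|V| * (D * D).
  rewrite ler_pM ?normr_coord_le// (le_trans (normr_relu_le _))//.
  by rewrite (le_trans (near_neuron_le _ _ yab))// ler_wpM2r//; lra.
have e2 : `|v j| * (`|act j y| * `|neuron V j y|) <= D * (1 * (`|V| * D)).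
  rewrite ler_pM ?mulr_ge0 ?(le_trans (normr_coord_le _ _) tD)// ler_pM//.
    exact: normr_heaviside_le.
  exact: near_neuron_le.
move: e1 e2; rewrite expr2; lra.
Qed.

(** The supremum is controlled by the weighted L2 norm because both parts of the decomposition have
    coefficients of order [sigma]. *)
Lemma residual_le y : y \in `[a, b] -> `|residual theta y| <= K5 * sg.
Proof.
move=> yab; rewrite residual_decomp// -dnetwork_lift// /residual_const mulrDl.
have k6 := feature_const_ge1; have sg0 := sigma_ge0 theta; have k3 := gap_const_gt0.
have ku := lift_const_gt0; have d2 := D_ge2.
rewrite (le_trans (ler_normD _ _))// lerD//.
  rewrite (le_trans (dnetwork_le _ yab))// -mulrA ler_wpM2l//; first by lra.
  by apply: normr_rV_ub => [|i]; [rewrite mulr_ge0// ltW|exact: lift_direction_le].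
rewrite (le_trans (ler_norm_sum _ _ _))//.
apply: (@le_trans _ _ (\sum_(1 <= j < H.+1) (K3 * D * sg))); last first.
  by rewrite sumr_const_nat subn1/= -[leLHS]mulr_natl !mulrA.
rewrite big_nat_cond [leRHS]big_nat_cond; apply: ler_sum => j; rewrite andbT => jH.
have D0 : 0 <= D by lra.
have rhs0 : 0 <= K3 * D * sg by rewrite mulr_ge0// mulr_ge0// ltW.
by rewrite (le_trans (kink_error_le jH yab))// ler_piMr//; case: ltP.
Qed.

End Fixed.

(** * Gradient inequalities and descent near the teacher *)

Lemma wint_near_sum_le (g : R -> R) (c e : R) : bounded_measurable a b g ->
  0 <= c -> 0 <= e ->
  (forall y, y \in `[a, b] ->
     g y <= c + \sum_(1 <= j < H.+1) e * ((`|y - xi j| < eta)%R)%:R) ->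
  wi g <= c * P * (b - a) + H%:R * e * (2 * eta * P).
Proof.
move=> bg c0 e0 gle.
have bnear j : bounded_measurable a b (fun y => e * ((`|y - xi j| < eta)%R)%:R).
  by apply: bounded_measurableM; [exact: bounded_measurable_cst|exact: bounded_measurable_near].
have bc : bounded_measurable a b (fun=> c) by exact: bounded_measurable_cst.
have bs : bounded_measurable a b
    (fun y => \sum_(1 <= j < H.+1) e * ((`|y - xi j| < eta)%R)%:R).
  exact: bounded_measurable_sum.
apply: (@le_trans _ _ (wi (fun y =>
    c + \sum_(1 <= j < H.+1) e * ((`|y - xi j| < eta)%R)%:R))).
  by apply: (le_wint bp p_ge0 bg _ gle); exact: bounded_measurableD.
rewrite (wintD bp bc bs) (wint_sum bp _ bnear) lerD//.
  exact: (wint_cst_le bp ab p_le).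
apply: (@le_trans _ _ (\sum_(1 <= j < H.+1) e * (2 * eta * P))); last first.
  by rewrite sumr_const_nat subn1/= -[leLHS]mulr_natl mulrA.
apply: ler_sum => j _; rewrite (wintZ bp); last exact: bounded_measurable_near.
by rewrite ler_wpM2l// (wint_near_le bp p_ge0 ab p_le)// ltW// eta_gt0.
Qed.

Lemma grad_dot theta V :
  wi (fun y => 2 * residual theta y * dnet theta V y) = \sum_i V 0 i * G theta 0 i.
Proof. by apply: (wint_dnetwork_dot _ bf bp) => i; exact: hG. Qed.

Lemma bounded_measurable_2residual theta (g : R -> R) : bounded_measurable a b g ->
  bounded_measurable a b (fun y => 2 * residual theta y * g y).
Proof.
move=> bg; apply: bounded_measurableM => //.
by apply: bounded_measurableM; [exact: bounded_measurable_cst|exact: bounded_measurable_residual].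
Qed.

Lemma sigma_le_grad theta : near_teacher theta -> sigma theta <= Kp * `|G theta|.
Proof.
move=> nt; set s := sigma theta; have s0 : 0 <= s by exact: sigma_ge0.
set u := lift_direction theta.
have bd : bounded_measurable a b (dnet theta u) by exact: bounded_measurable_dnetwork.
have br := bounded_measurable_residual theta.
have k5 := residual_const_gt0; have k3 := gap_const_gt0; have d2 := D_ge2; have ku := lift_const_gt0.
have D0 : 0 <= D by lra.
have split2 : 2 * loss theta = wi (fun y => 2 * residual theta y * dnet theta u y)
    + wi (fun y => 2 * residual theta y * (residual theta y - dnet theta u y)).
  rewrite -(wintD bp); last 2 first.
  - exact: bounded_measurable_2residual.
  - by apply: bounded_measurable_2residual; exact: bounded_measurableB.
  rewrite -(wintZ bp); last exact: bounded_measurableX.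
  by apply: eq_wint => y _; ring.
have dot_le : wi (fun y => 2 * residual theta y * dnet theta u y) <= Kp * s * `|G theta|.
  rewrite grad_dot; apply: (@le_trans _ _ (\sum_(i < (3 * H).+1) Ku * s * `|G theta|)).
    apply: ler_sum => i _; apply: le_trans (ler_norm _) _; rewrite normrM ler_pM//.
      exact: lift_direction_le.
    exact: normr_rV_le.
  rewrite sumr_const card_ord -[leLHS]mulr_natl /gradient_const; lra.
(* The residual and the kink error contribute one factor [s] each, and [eta_small] bounds the
   remaining coefficient by 1. *)
have err_le : wi (fun y => 2 * residual theta y * (residual theta y - dnet theta u y))
    <= s ^+ 2.
  have e0 : 0 <= 2 * (K5 * s) * (K3 * D * s).
    have := mulr_ge0 (ltW k5) s0; have := mulr_ge0 (mulr_ge0 (ltW k3) D0) s0 => h1 h2.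
    by rewrite mulr_ge0// mulr_ge0.
  apply: le_trans (wint_near_sum_le _ (lexx 0) e0 _) _.
  - by apply: bounded_measurable_2residual; exact: bounded_measurableB.
  - move=> y yab; rewrite add0r -mulr_sumr.
    have -> : residual theta y - dnet theta u y = \sum_(1 <= j < H.+1) kink_error theta j y.
      by rewrite residual_decomp// -dnetwork_lift// addrC addKr.
    apply: le_trans (ler_norm _) _; rewrite -mulrA 2!normrM normr_nat -2!mulrA.
    rewrite ler_wpM2l// ler_pM//; first exact: residual_le.
    rewrite (le_trans (ler_norm_sum _ _ _))// mulr_sumr.
    rewrite big_nat_cond [leRHS]big_nat_cond; apply: ler_sum => j; rewrite andbT => jH.
    exact: kink_error_le.
  rewrite !mul0r add0r (_ : _ * _ = (4 * H%:R * K5 * K3 * D * P * eta) * s ^+ 2); last by ring.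
  by rewrite ler_piMl ?sqr_ge0// eta_small.
have main : s * s <= s * (Kp * `|G theta|).
  have := sqr_sigma theta; rewrite -/s => e; move: split2 dot_le err_le; rewrite -e; lra.
have [->|sn0] := eqVneq s 0; first by rewrite mulr_ge0// ltW// gradient_const_gt0.
by move: main; rewrite ler_pM2l// lt_neqAle eq_sym sn0.
Qed.

Definition gradient_bound := 2 * K5 * K6 * P * (b - a).

Lemma gradient_bound_ge0 : 0 <= gradient_bound.
Proof.
have k5 := residual_const_gt0; have k6 := feature_const_ge1; have h := ab; have pp := P_gt0.
by rewrite mulr_ge0 ?subr_ge0 ?(ltW h)// mulr_ge0 ?(ltW pp)// mulr_ge0; lra.
Qed.

Lemma grad_le_sigma theta : near_teacher theta -> `|G theta| <= gradient_bound * sigma theta.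
Proof.
move=> nt; have s0 := sigma_ge0 theta.
have k5 := residual_const_gt0; have k6 := feature_const_ge1.
apply: normr_rV_ub => [|i]; first by rewrite mulr_ge0// gradient_bound_ge0.
have bd : bounded_measurable a b
    (fun y => 2 * residual theta y * dnet theta (delta_mx 0 i) y).
  by apply: bounded_measurable_2residual; exact: bounded_measurable_dnetwork.
rewrite hG (le_trans (normr_wint bp p_ge0 bd))//.
have c0 : 0 <= 2 * (K5 * sigma theta) * K6.
  by rewrite mulr_ge0; [|rewrite mulr_ge0// mulr_ge0// ltW|lra].
apply: le_trans (wint_le bp p_ge0 ab p_le (bounded_measurable_norm bd) c0 _) _.
  move=> y yab; rewrite 2!normrM normr_nat ler_pM ?mulr_ge0//.
    by rewrite ler_wpM2l// residual_le.
  rewrite (le_trans (dnetwork_le nt _ yab))// ler_piMr//; first by lra.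
  apply: normr_rV_ub => // j; rewrite mxE; case: (_ && _); rewrite ?normr1 ?normr0//.
by rewrite /gradient_bound; lra.
Qed.

Lemma near_v_le theta j : near_teacher theta -> `|coord theta (2 * H + j)| <= D.
Proof. by move=> nt; apply: le_trans (normr_coord_le _ _) (near_norm_le nt). Qed.

Lemma neuronB theta1 theta2 j y :
  neuron (theta2 - theta1) j y = neuron theta2 j y - neuron theta1 j y.
Proof. by rewrite -[- theta1]scaleN1r addrC neuron_line; ring. Qed.

Lemma neuron_lipschitz theta1 theta2 j y : y \in `[a, b] ->
  `|neuron theta2 j y - neuron theta1 j y| <= `|theta2 - theta1| * D.
Proof. by move=> yab; rewrite -neuronB near_neuron_le. Qed.

(** Neurons beyond [N] stay inactive, so the constant involves [N] and not [H], as the prescribed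
    step size demands. *)
Lemma network_lipschitz theta1 theta2 y : near_teacher theta1 -> near_teacher theta2 ->
  y \in `[a, b] ->
  `|net theta2 y - net theta1 y| <= (2 * N%:R + 1) * D ^+ 2 * `|theta2 - theta1|.
Proof.
move=> n1 n2 yab; have d2 := D_ge2; set d := `|theta2 - theta1|.
have d0 : 0 <= d by exact: normr_ge0.
have coordB k : coord theta2 k - coord theta1 k = coord (theta2 - theta1) k.
  by rewrite /Defs.coord !mxE.
rewrite /network opprD addrACA -sumrB coordB.
have NH : (N <= H)%N by case/andP: HN.
rewrite (@big_cat_nat _ _ _ N.+1)//=.
rewrite [X in _ + (_ + X)]big_nat_cond [X in _ + (_ + X)]big1 ?addr0; last first.
  by move=> j; rewrite andbT => /andP[Nj jH]; rewrite !reluE !heaviside_last ?Nj//; ring.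
rewrite (le_trans (ler_normD _ _))//.
have hc : `|coord (theta2 - theta1) (3 * H + 1)| <= d by exact: normr_coord_le.
have hs : `|\sum_(1 <= j < N.+1) (coord theta2 (2 * H + j) * relu (neuron theta2 j y)
     - coord theta1 (2 * H + j) * relu (neuron theta1 j y))| <= N%:R * (2 * D ^+ 2 * d).
  rewrite (le_trans (ler_norm_sum _ _ _))//.
  apply: (@le_trans _ _ (\sum_(1 <= j < N.+1) (2 * D ^+ 2 * d))); last first.
    by rewrite sumr_const_nat subn1/= -[leLHS]mulr_natl.
  rewrite big_nat_cond [leRHS]big_nat_cond; apply: ler_sum => j; rewrite andbT => /andP[j0 jN].
  have jH : (0 < j <= H)%N by rewrite j0 (leq_trans _ NH).
  rewrite (_ : _ - _ = coord theta2 (2 * H + j) * (relu (neuron theta2 j y)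
      - relu (neuron theta1 j y)) + coord (theta2 - theta1) (2 * H + j)
      * relu (neuron theta1 j y)); last by rewrite -coordB; ring.
  rewrite (le_trans (ler_normD _ _))// !normrM.
  have e1 : `|coord theta2 (2 * H + j)| * `|relu (neuron theta2 j y) - relu (neuron theta1 j y)|
      <= D * (d * D).
    rewrite ler_pM ?near_v_le// (le_trans (relu_lipschitz _ _))//.
    exact: neuron_lipschitz.
  have e2 : `|coord (theta2 - theta1) (2 * H + j)| * `|relu (neuron theta1 j y)| <= d * D.
    rewrite ler_pM ?normr_coord_le// (le_trans (normr_relu_le _))//.
    have h1 := near_neuron n1 jH yab; have h2 : `|y - xi j| <= D - 1.
      by apply: xi_dist => //; rewrite j0.
    have := ler_normD (neuron theta1 j y - (y - xi j)) (y - xi j); rewrite subrK.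
    by move: h1 h2 (eta_le1); lra.
  have e3 : d * D <= d * D * D by rewrite ler_peMr ?mulr_ge0//; lra.
  move: e1 e2 e3; rewrite expr2; lra.
have e4 : d <= D ^+ 2 * d by rewrite ler_peMl// expr2; nra.
move: hc hs e4; lra.
Qed.

(** Away from a knot both parameters have the same activation and a neuron's remainder is a product
    of two increments; near it only [relu_taylor_le] is available. *)
Lemma network_taylor theta1 theta2 y : near_teacher theta1 -> near_teacher theta2 ->
  y \in `[a, b] ->
  `|net theta2 y - net theta1 y - dnet theta1 (theta2 - theta1) y|
  <= H%:R * (D * `|theta2 - theta1| ^+ 2) + \sum_(1 <= j < H.+1)
       D ^+ 2 * `|theta2 - theta1| * ((`|y - xi j| < eta)%R)%:R.
Proof.
move=> n1 n2 yab; have d2 := D_ge2; set d := `|theta2 - theta1|.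
have d0 : 0 <= d by exact: normr_ge0.
have D0 : 0 <= D by lra.
have coordB k : coord theta2 k - coord theta1 k = coord (theta2 - theta1) k.
  by rewrite /Defs.coord !mxE.
rewrite /network /dnetwork [X in `|X - _|](_ : _ = coord (theta2 - theta1) (3 * H + 1)
   + \sum_(1 <= j < H.+1) (coord theta2 (2 * H + j) * relu (neuron theta2 j y)
     - coord theta1 (2 * H + j) * relu (neuron theta1 j y))); last first.
  by rewrite -coordB sumrB; ring.
rewrite opprD addrACA subrr add0r -sumrB (le_trans (ler_norm_sum _ _ _))//.
have -> : H%:R * (D * d ^+ 2) = \sum_(1 <= j < H.+1) (D * d ^+ 2).
  by rewrite sumr_const_nat subn1/= -[RHS]mulr_natl.
rewrite -big_split/=; apply: ler_sum_nat => j jH.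
set z1 := neuron theta1 j y; set z2 := neuron theta2 j y.
rewrite neuronB -/z1 -/z2 -coordB (_ : _ - _ - _ =
    (coord theta2 (2 * H + j) - coord theta1 (2 * H + j)) * (relu z2 - relu z1)
    + coord theta1 (2 * H + j) * (relu z2 - relu z1 - heaviside z1 * (z2 - z1))); last by ring.
have zz : `|z2 - z1| <= d * D by exact: neuron_lipschitz.
rewrite coordB (le_trans (ler_normD _ _))// !normrM lerD//.
  rewrite (_ : D * d ^+ 2 = d * (d * D)); last by ring.
  by rewrite ler_pM ?normr_coord_le// (le_trans (relu_lipschitz _ _)).
have [near|far] := ltP.
  rewrite mulr1 (_ : D ^+ 2 * d = D * (d * D)); last by ring.
  by rewrite ler_pM ?near_v_le// (le_trans (relu_taylor_le _ _)).
rewrite !reluE /z1 /z2 !(heaviside_far _ jH yab far)// (_ : _ - _ - _ = 0); last by ring.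
by rewrite normr0 mulr0 mulr0.
Qed.

Lemma loss_le_dist theta : near_teacher theta ->
  loss theta <= ((2 * N%:R + 1) * D ^+ 2) ^+ 2 * P * (b - a) * `|theta - teacher| ^+ 2.
Proof.
move=> nt; have nt0 : near_teacher teacher by rewrite /near_teacher subrr normr0 eps_gt0.
set K := (2 * N%:R + 1) * D ^+ 2; set d := `|theta - teacher|.
have teacherE y : y \in `[a, b] -> net teacher y = f y.
  move=> yab; rewrite fE// /network coord_param_c; congr (_ + _).
  apply: eq_big_nat => j jH; rewrite coord_param_v// /neuron coord_param_w// coord_param_b//.
  by rewrite mul1r.
apply: le_trans (wint_le bp p_ge0 ab p_le (c := (K * d) ^+ 2) _ _ _) _.
- by apply: bounded_measurableX; exact: bounded_measurable_residual.
- exact: sqr_ge0.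
- move=> y yab; rewrite /residual -teacherE// -[leLHS]real_normK ?num_real//.
  have h := network_lipschitz nt0 nt yab.
  by rewrite lerXn2r ?nnegrE// (le_trans _ h).
by rewrite le_eqVlt; apply/orP; left; apply/eqP; ring.
Qed.

Lemma loss_descent (hmax : R) theta h :
  4 * (2 * N%:R + 1) ^+ 2 * D ^+ 5 * P * hmax <= 1 ->
  0 < h <= hmax -> near_teacher theta -> near_teacher (theta - h *: G theta) ->
  loss (theta - h *: G theta) <= loss theta - h / 2 * `|G theta| ^+ 2.
Proof.
move=> hmaxP /andP[h0 hh] nt nt'; set theta' := theta - h *: G theta.
have k5 := residual_const_gt0; have kp := gradient_const_gt0; have d2 := D_ge2.
have pp := P_gt0; have ab0 : 0 <= b - a by rewrite subr_ge0 ltW// ab.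
have s0 := sigma_ge0 theta; have sg := sigma_le_grad nt.
set g := `|G theta| in sg *; have g0 : 0 <= g by exact: normr_ge0.
set s := sigma theta in s0 sg *.
have dE : theta' - theta = - h *: G theta by rewrite /theta' addrC addKr scaleNr.
have dn : `|theta' - theta| = h * g by rewrite dE normrZ normrN gtr0_norm.
set d := `|theta' - theta| in dn *; have d0 : 0 <= d by exact: normr_ge0.
have d_eps : d <= 2 * eps.
  have := ler_distD teacher theta' theta; rewrite -/d [`|teacher - _|]distrC.
  by move: nt nt'; rewrite /near_teacher -/theta'; lra.
pose r := residual theta; pose r' := residual theta'.
pose dl := dnet theta (theta' - theta).
have br : bounded_measurable a b r by exact: bounded_measurable_residual.
have br' : bounded_measurable a b r' by exact: bounded_measurable_residual.
have bd : bounded_measurable a b dl by exact: bounded_measurable_dnetwork.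
(* Everything in [r' ^+ 2 - r ^+ 2] beyond the linear term [2 * r * dl]. Its integral must use at
   most half of the gain [h * g ^+ 2]. *)
pose q y := 2 * r y * (r' y - r y - dl y) + (r' y - r y) ^+ 2.
have bq : bounded_measurable a b q.
  apply: bounded_measurableD.
    apply: bounded_measurable_2residual; apply: bounded_measurableB => //.
    exact: bounded_measurableB.
  by apply: bounded_measurableX; exact: bounded_measurableB.
have lossE : loss theta' = loss theta + wi (fun y => 2 * r y * dl y) + wi q.
  rewrite /loss -(wintD bp); last 2 first.
  - exact: bounded_measurableX.
  - exact: bounded_measurable_2residual.
  rewrite -(wintD bp) => [|//|//]; last first.
    by apply: bounded_measurableD; [exact: bounded_measurableX|exact: bounded_measurable_2residual].
  by apply: eq_wint => y _; rewrite /q -/r -/r'; ring.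
have lin : wi (fun y => 2 * r y * dl y) <= - (h * g ^+ 2).
  rewrite /dl /r grad_dot dE.
  rewrite (_ : \sum_i _ = - (h * \sum_i G theta 0 i ^+ 2)); last first.
    by rewrite mulr_sumr -sumrN; apply: eq_bigr => i _; rewrite mxE; ring.
  by rewrite lerN2 ler_wpM2l ?(ltW h0)// sqr_normr_le_sum.
set K := (2 * N%:R + 1) * D ^+ 2.
have rest : wi q <= (2 * (K5 * s) * (H%:R * (D * d ^+ 2)) + (K * d) ^+ 2) * P * (b - a)
    + H%:R * (2 * (K5 * s) * (D ^+ 2 * d)) * (2 * eta * P).
  have ks : 0 <= 2 * (K5 * s) by rewrite mulr_ge0// mulr_ge0// ltW.
  have D0 : 0 <= D by lra.
  apply: wint_near_sum_le => //.
  - by rewrite addr_ge0 ?sqr_ge0// mulr_ge0// mulr_ge0// mulr_ge0 ?sqr_ge0.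
  - by rewrite mulr_ge0// mulr_ge0 ?sqr_ge0.
  move=> y yab; rewrite /q [leRHS]addrAC lerD//; last first.
    rewrite -[leLHS]real_normK ?num_real//.
    have e : r' y - r y = net theta' y - net theta y.
      by rewrite /r /r' /residual; ring.
    have hl := network_lipschitz nt nt' yab.
    by rewrite e lerXn2r ?nnegrE// (le_trans _ hl).
  under eq_bigr do rewrite -mulrA; rewrite -mulr_sumr -mulrDr.
  apply: le_trans (ler_norm _) _; rewrite 2!normrM normr_nat ler_pM ?mulr_ge0//.
    by rewrite ler_wpM2l// residual_le.
  have -> : r' y - r y - dl y = net theta' y - net theta y - dl y.
    by rewrite /r /r' /residual; ring.
  exact: network_taylor.
(* Product terms: [s <= Kp * g], one [d] equals [h * g], and the other is at most [2 * eps]. *)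
have T1 : 2 * (K5 * s) * (H%:R * (D * d ^+ 2)) * P * (b - a) <= h * g ^+ 2 / 8.
  have c0 : 0 <= 2 * K5 * H%:R * D * P * (b - a).
    have D0 : 0 <= D by lra.
    by rewrite mulr_ge0// mulr_ge0 ?(ltW pp)// mulr_ge0// mulr_ge0// mulr_ge0// ltW.
  have e1 : s * d * d <= Kp * g * d * (2 * eps).
    by rewrite ler_pM ?mulr_ge0// ler_wpM2r.
  have e2 := ler_wpM2l c0 e1; have hg2 : 0 <= h * g ^+ 2 by rewrite mulr_ge0 ?sqr_ge0// ltW.
  have e3 := ler_wpM2r hg2 eps_desc.
  move: e2 e3; rewrite dn; lra.
(* The square of the increment has no small factor besides [h], so this term uses the bound on
   [hmax]. *)
have T2 : (K * d) ^+ 2 * P * (b - a) <= h * g ^+ 2 / 4.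
  have D0 : 0 <= D by lra.
  have hg2 : 0 <= h * g ^+ 2 by rewrite mulr_ge0 ?sqr_ge0// ltW.
  have c0 : 0 <= (2 * N%:R + 1) ^+ 2 * D ^+ 4 * P.
    by rewrite mulr_ge0 ?(ltW pp)// mulr_ge0 ?sqr_ge0// exprn_ge0.
  have e1 : (b - a) * h <= D * hmax by rewrite ler_pM ?ba_le// ltW.
  have e2 := ler_wpM2r hg2 (ler_wpM2l c0 e1); have e3 := ler_wpM2r hg2 hmaxP.
  have -> : (K * d) ^+ 2 * P * (b - a)
      = (2 * N%:R + 1) ^+ 2 * D ^+ 4 * P * ((b - a) * h) * (h * g ^+ 2).
    by rewrite dn /K; ring.
  apply: le_trans e2 _; move: e3; lra.
(* Near-knot terms: of first order in [d], with [s <= Kp * g] giving the second factor [g] and [eta]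
   the smallness. *)
have T3 : H%:R * (2 * (K5 * s) * (D ^+ 2 * d)) * (2 * eta * P) <= h * g ^+ 2 / 8.
  have hg2 : 0 <= h * g ^+ 2 by rewrite mulr_ge0 ?sqr_ge0// ltW.
  have c0 : 0 <= 4 * H%:R * K5 * D ^+ 2 * eta * P * d.
    rewrite mulr_ge0// mulr_ge0 ?(ltW pp)// mulr_ge0 ?(ltW eta_gt0)// mulr_ge0 ?sqr_ge0//.
    by rewrite mulr_ge0 ?(ltW k5)// mulr_ge0.
  have e2 := ler_wpM2l c0 sg; have e3 := ler_wpM2r hg2 eta_desc.
  move: e2 e3; rewrite dn; lra.
rewrite lossE; move: lin rest T1 T2 T3; lra.
Qed.

End Near.
(** Dividing by the sum of all coefficients to be absorbed meets all conditions at once; [eta] is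
    fixed before [eps]. *)
Lemma radii_exist : exists eta eps, radii eta eps.
Proof.
pose A1 := 4 * H%:R * K5 * K3 * D * P; pose A2 := 32 * K5 * Kp * D ^+ 2 * H%:R * P.
pose A3 := 32 * K5 * Kp * H%:R * D * P * (b - a).
have k5 := ltW residual_const_gt0; have k3 := ltW gap_const_gt0.
have kp := ltW gradient_const_gt0; have pp := ltW P_gt0; have l0 := lam_gt0; have l1 := lam_le1.
have D0 : 0 <= D by have := D_ge2; lra.
have b0 := beta0_gt0.
have A10 : 0 <= A1 by rewrite mulr_ge0// mulr_ge0// mulr_ge0// mulr_ge0// mulr_ge0.
have A20 : 0 <= A2.
  by rewrite mulr_ge0// mulr_ge0// mulr_ge0 ?sqr_ge0// mulr_ge0// mulr_ge0.
have A30 : 0 <= A3.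
  rewrite mulr_ge0 ?subr_ge0 ?(ltW ab)// mulr_ge0// mulr_ge0// mulr_ge0// mulr_ge0//.
  by rewrite mulr_ge0.
have B0 : 0 < 2 / beta0 by rewrite divr_gt0.
have frac (c X e : R) : 0 <= e -> 0 <= c <= X -> 0 < X -> c * (e / X) <= e.
  move=> e0 /andP[c0 cX] X0; rewrite mulrA ler_pdivrMr// mulrC.
  by rewrite ler_wpM2l.
pose X1 := 1 + A1 + A2; pose X2 := 2 + D + A3 + 2 / beta0.
pose eta := lam / X1; pose eps := eta / X2.
have X10 : 0 < X1 by rewrite /X1; lra.
have X20 : 0 < X2 by rewrite /X2; lra.
have eta_gt0 : 0 < eta by rewrite divr_gt0.
have eta_frac c : 0 <= c <= X1 -> c * eta <= lam by move=> h; apply: frac => //; exact: ltW.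
have eps_frac c : 0 <= c <= X2 -> c * eps <= eta by move=> h; apply: frac => //; exact: ltW.
have eta_le : eta <= lam by rewrite -[leLHS]mul1r eta_frac// /X1; lra.
have eps_gt0 : 0 < eps by rewrite divr_gt0.
exists eta, eps; split.
- by rewrite eta_gt0.
- have : 2 * eps <= eta by apply: eps_frac; rewrite /X2; lra.
  by rewrite eps_gt0/=; lra.
- by rewrite mulrC eps_frac// /X2; lra.
- have : 2 / beta0 * eps <= eta by apply: eps_frac; rewrite /X2; lra.
  by rewrite mulrAC ler_pdivrMr//; nra.
- by rewrite -/A1 (le_trans (eta_frac _ _))// /X1; lra.
- by rewrite -/A2 (le_trans (eta_frac _ _))// /X1; lra.
- by rewrite -/A3 (le_trans (eps_frac _ _)) ?(le_trans eta_le)// /X2; lra.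
Qed.

Lemma local_convergence (hmax : R) : 0 < hmax ->
  4 * (2 * N%:R + 1) ^+ 2 * D ^+ 5 * P * hmax <= 1 ->
  exists c C delta : R, [/\ 0 < c, 0 < C, 0 < delta <= 1 / 2 &
  forall (h : nat -> R) (Th : nat -> 'rV[R]_(3 * H).+1),
    `|Th 0 - teacher| < delta ->
    (forall k, 0 < h k <= hmax) ->
    (forall k, Th k.+1 = Th k - h k *: G (Th k)) ->
    forall k, loss (Th k) <= C * expR (- (c * \sum_(i < k) h i))].
Proof.
move=> hmax0 hmaxP; have [eta [eps rd]] := radii_exist.
have kp := gradient_const_gt0; have eps_gt0 := eps_gt0 rd; have eps_le_half := eps_le_half rd.
have ab0 : 0 <= b - a by rewrite subr_ge0 ltW// ab.
pose mu0 := (Kp ^+ 2)^-1; have mu0_gt0 : 0 < mu0 by rewrite invr_gt0 exprn_gt0.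
pose C0 := ((2 * N%:R + 1) * D ^+ 2) ^+ 2 * P * (b - a).
have C00 : 0 <= C0 by rewrite mulr_ge0// mulr_ge0 ?sqr_ge0// ltW// P_gt0.
have PL theta : near_teacher eps theta -> mu0 * loss theta <= `|G theta| ^+ 2.
  move=> nt; rewrite -sqr_sigma /mu0 mulrC ler_pdivrMr ?exprn_gt0// -exprMn mulrC.
  have kg : 0 <= Kp * `|G theta| by apply: mulr_ge0 => //; exact: ltW.
  by rewrite lerXn2r ?nnegrE ?sigma_ge0// (sigma_le_grad rd).
have UB theta : near_teacher eps theta ->
    `|G theta| ^+ 2 <= gradient_bound ^+ 2 * loss theta.
  move=> nt; rewrite -sqr_sigma -exprMn lerXn2r ?nnegrE//; last exact: (grad_le_sigma rd).
  by apply: mulr_ge0; [exact: gradient_bound_ge0|exact: sigma_ge0].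
have [delta [/andP[d0 de] conv]] := @local_descent R _ loss G teacher eps mu0
  (gradient_bound ^+ 2) C0 hmax eps_gt0 mu0_gt0 (sqr_ge0 _) C00 hmax0 loss_ge0 PL UB
  (fun theta h hh nt nt' => loss_descent rd hmaxP hh nt nt')
  (fun theta nt => loss_le_dist rd nt).
exists (mu0 / 2), (C0 * eps ^+ 2 + 1), delta; split.
- by rewrite divr_gt0.
- by rewrite ltr_wpDl// mulr_ge0 ?sqr_ge0.
- by rewrite d0 (le_trans de).
move=> h Th Th0 hh hTh k; apply: le_trans (conv h Th Th0 hh hTh k) _.
by rewrite ler_wpM2r ?expR_ge0// lerDl.
Qed.

End LocalAnalysis.

(** * Piecewise affine targets *)

(** Supplies the least distance of break points and the least nonzero slope jump. *)
Lemma finite_pos_lower_bound (R : realType) (n : nat) (Q : pred nat) (F : nat -> R) :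
  (forall i, (i < n)%N -> Q i -> 0 < F i) ->
  exists2 m : R, 0 < m & forall i, (i < n)%N -> Q i -> m <= F i.
Proof.
elim: n => [|n ih] F0; first by exists 1.
have [m m0 mF] := ih (fun i ni => F0 i (ltnW ni)).
have [Qn|nQn] := boolP (Q n); last first.
  exists m => // i; rewrite ltnS leq_eqVlt => /predU1P[->|/mF//].
  by rewrite (negPf nQn).
exists (Num.min m (F n)); first by rewrite lt_min m0 F0.
move=> i; rewrite ltnS leq_eqVlt => /predU1P[-> _|/mF h /h mi]; rewrite ge_min ?lexx ?orbT//.
by rewrite mi.
Qed.

Lemma lipschitz_within_continuous (R : realType) (k : R) (A : set R) (p : R -> R) :
  k.-lipschitz_A p -> {within A, continuous p}.
Proof.
move=> pk; apply/subspace_continuousP => y Ay; apply/cvgrPdist_lt => e e0.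
(* The given constant [k] may be zero or negative. *)
pose K := `|k| + 1; have K0 : 0 < K by rewrite ltr_wpDl.
have eK : 0 < e / K by rewrite divr_gt0.
apply: filterS (nbhsx_ballx y _ eK) => z yz Az.
have := pk (y, z) (conj Ay Az) => /= h; apply: le_lt_trans h _.
apply: (@le_lt_trans _ _ (K * `|y - z|)).
  by rewrite ler_wpM2r// /K; have := ler_norm k; lra.
by rewrite mulrC -ltr_pdivlMr.
Qed.

(** Compare factors: 2N+1 <= 3N+1, and 4(2N+1)D^5 = 4D^5 + 8N D^5 <= 24D^5 + 16N D^7. *)
Lemma step_size_bound (R : realType) (N : nat) (D P : R) : 2 <= D -> 0 < P ->
  let B := (3 * N + 1)%:R * (24 * D ^+ 5 + 16 * N%:R * D ^+ 7) * P in
  0 < B /\ 4 * (2 * N%:R + 1) ^+ 2 * D ^+ 5 * P * B^-1 <= 1.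
Proof.
move=> D2 P0 B; have D50 : 0 < D ^+ 5 by rewrite exprn_gt0//; lra.
have D7 : D ^+ 5 <= D ^+ 7.
  by rewrite -[7%N]/(5 + 2)%N exprD ler_peMr ?(ltW D50)// exprn_ege1//; lra.
have n0 : 0 <= N%:R :> R by exact: ler0n.
have nD7 : 0 <= N%:R * D ^+ 7 - N%:R * D ^+ 5 by rewrite subr_ge0 ler_wpM2l.
have nD5 : 0 <= N%:R * D ^+ 5 by rewrite mulr_ge0// ltW.
have B0 : 0 < B.
  by rewrite mulr_gt0// mulr_gt0 ?ltr0n ?addn1//; lra.
split=> //; rewrite ler_pdivrMr// mul1r /B ler_wpM2r ?(ltW P0)//.
rewrite natrD natrM (_ : 4 * (2 * N%:R + 1) ^+ 2 * D ^+ 5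
  = (2 * N%:R + 1) * (4 * (2 * N%:R + 1) * D ^+ 5)); last by ring.
have c0 : 0 <= 2 * N%:R + 1 :> R by lra.
apply: ler_pM => //; [|by lra|by lra].
by apply: mulr_ge0 (ltW D50); lra.
Qed.

Section PiecewiseAffine.
Variables (R : realType) (H N : nat) (a b : R) (f : R -> R) (x alpha : nat -> R).
Hypotheses (hN : (1 <= N <= H)%N) (hx0 : x 0%N = a) (hxN : x N = b).
Hypothesis hx : forall i : nat, (1 <= i <= N)%N -> x i.-1 < x i.
Hypothesis hlin : forall i : nat, (1 <= i <= N)%N ->
  forall y : R, y \in `[x i.-1, x i] -> f y = f (x i.-1) + alpha i * (y - x i.-1).

Lemma break_le i j : (i <= j <= N)%N -> x i <= x j.
Proof.
elim: j => [|j ih] /andP[ij jN]; first by move: ij; rewrite leqn0 => /eqP ->.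
move: ij; rewrite leq_eqVlt => /predU1P[->//|ij].
by apply: le_trans (ih _) (ltW (hx (i := j.+1) jN)); rewrite -ltnS ij ltnW.
Qed.

Lemma break_in i : (i <= N)%N -> a <= x i <= b.
Proof. by move=> iN; rewrite -hx0 -hxN !break_le ?leq0n ?iN ?leqnn. Qed.

Lemma piece_of y : a <= y <= b -> exists2 i, (1 <= i <= N)%N & x i.-1 <= y <= x i.
Proof.
move=> /andP[ay]; rewrite -hxN; have /andP[N0 _] := hN.
suff piece n : (0 < n <= N)%N -> y <= x n ->
    exists2 i, (1 <= i <= N)%N & x i.-1 <= y <= x i.
  by apply: piece; rewrite N0 leqnn.
elim: n => // n ih /= nN yn; have [yx|xy] := leP y (x n); last first.
  by exists n.+1; rewrite //= (ltW xy).
have [n0|n0] := posnP n; last by apply: ih; rewrite // n0 ltnW.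
by exists 1%N; rewrite // n0 in yn; rewrite /= hx0 ay.
Qed.

(* The first knot lies left of a and the unused ones right of b, so these neurons are
   active, respectively inactive, on the whole of [a, b]. *)
Definition knot (j : nat) : R :=
  if (j <= 1)%N then a - 1 else if (j <= N)%N then x j.-1 else b + 1.

(** The first neuron carries the whole initial slope. As its knot is [a - 1], it equals [alpha 1] at
    [a], whence the output bias [f a - alpha 1]. *)
Definition slope_jump (j : nat) : R :=
  if j == 1%N then alpha 1 else if (1 < j <= N)%N then alpha j - alpha j.-1 else 0.

Lemma sum_slope_jump i y : (1 <= i <= N)%N ->
  f a - alpha 1 + \sum_(1 <= j < i.+1) slope_jump j * (y - knot j)
  = f (x i.-1) + alpha i * (y - x i.-1).
Proof.
elim: i => // i ih /andP[_ iN]; have [i0|i0] := posnP i.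
  by rewrite i0 big_nat1 /slope_jump /knot/= hx0; ring.
rewrite big_nat_recr//= addrA ih ?i0 ?(ltnW iN)//.
have i1N : (1 <= i <= N)%N by rewrite i0 ltnW.
have xi : x i \in `[x i.-1, x i] by rewrite in_itv/= lexx ltW ?hx.
rewrite (hlin i1N xi) /slope_jump /knot eqSS gtn_eqF// ltnS i0 iN/= leqNgt ltnS i0/=.
ring.
Qed.

Lemma piecewise_affine_network y : y \in `[a, b] ->
  f y = f a - alpha 1 + \sum_(1 <= j < H.+1) slope_jump j * relu (y - knot j).
Proof.
rewrite in_itv/= => yab; have [i iN yi] := piece_of yab.
have yi' : y \in `[x i.-1, x i] by rewrite in_itv.
have /andP[i0 iN'] := iN; have /andP[_ NH] := hN; have /andP[y1 y2] := yi.
have iH : (i <= H)%N by exact: leq_trans iN' NH.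
rewrite (hlin iN yi') -sum_slope_jump// [in RHS](@big_cat_nat _ _ _ i.+1)//=.
rewrite [X in _ + (_ + X)]big_nat_cond [X in _ + (_ + X)]big1 ?addr0; last first.
  move=> j; rewrite andbT => /andP[ij _]; have j1 : (1 < j)%N by exact: leq_ltn_trans ij.
  rewrite /slope_jump /knot (gtn_eqF j1) [(j <= 1)%N]leqNgt j1/=; case: ifPn => [jN|_]; last by rewrite mul0r.
  rewrite /relu max_r ?mulr0// subr_le0 (le_trans y2)// break_le//.
  by rewrite (leq_trans (leq_pred _) jN) andbT -ltnS prednK// (ltn_trans _ j1).
congr (_ + _); apply: eq_big_nat => j /andP[j0 ji].
rewrite /relu max_l// subr_ge0 /knot; case: ifPn => [_|].
  by case/andP: yab; lra.
rewrite -ltnNge => j1; rewrite (leq_trans _ iN')//.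
apply: le_trans y1; apply: break_le; rewrite (leq_trans (leq_pred _) iN') andbT.
by rewrite -ltnS !prednK// (ltn_trans _ j1).
Qed.

End PiecewiseAffine.

(** * Convergence for piecewise affine targets *)

Theorem theorem5p3 (R : realType) (H : nat) (hH : (0 < H)%N) (a b : R)
  (hab : a < b) (f p : R -> R)
  (hf : {within `[a, b], continuous f})
  (hp : forall x, x \in `[a, b] -> 0 < p x)
  (hpL : exists k : R, k.-lipschitz_(`[a, b]%classic) p)
  (chi : nat -> R -> R) (hchi : relu_approximation chi)
  (G : 'rV[R]_(3 * H).+1 -> 'rV[R]_(3 * H).+1)
  (hG : generalized_gradient a b f p chi G)
  (N : nat) (hN : (1 <= N <= H)%N)
  (rho : R) (hrho : 0 <= rho < 1)
  (x alpha : nat -> R)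
  (hx0 : x 0%N = a) (hxN : x N = b)
  (hx : forall i : nat, (1 <= i <= N)%N -> x i.-1 < x i)
  (hlin : forall i : nat, (1 <= i <= N)%N ->
     forall y : R, y \in `[x i.-1, x i] ->
       f y = f (x i.-1) + alpha i * (y - x i.-1))
  (D : R)
  (hD : D = 1 + `|f a|
    + (1 + 2 * \big[Num.max/0]_(1 <= j < N.+1) `|alpha j|)
      * (`|a| + `|b| + 1))
  (Theta : 'rV[R]_(3 * H).+1 -> R -> nat -> 'rV[R]_(3 * H).+1)
  (hTheta0 : forall theta gamma, Theta theta gamma 0%N = theta)
  (hThetaS : forall theta gamma (n : nat), (1 <= n)%N ->
     Theta theta gamma n =
       Theta theta gamma n.-1
       - (gamma / (n%:R `^ rho)) *: G (Theta theta gamma n.-1)) :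
  exists (c C : R) (U : set 'rV[R]_(3 * H).+1),
    [/\ 0 < c /\ 0 < C, U !=set0, open U,
        (forall theta, U theta -> forall i, theta 0 i \in `]- D, D[)
      & forall theta gamma (n : nat),
          U theta ->
          gamma \in `]0, ((3 * N + 1)%:R
                          * (24 * D ^+ 5 + 16 * N%:R * D ^+ 7)
                          * sup [set p y | y in `[a, b]])^-1] ->
          risk a b f p (Theta theta gamma n)
            <= C * expR (- c * gamma * n%:R `^ (1 - rho))].
Proof.
have [k pk] := hpL; have cp := lipschitz_within_continuous pk.
have bp := within_continuous_bounded_measurable cp.
have bf := within_continuous_bounded_measurable hf.
have hG' := generalized_gradientE bf bp hchi hG.
set P := sup [set p y | y in `[a, b]].
have aab : a \in `[a, b] by rewrite in_itv/= lexx ltW.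
have pP y : y \in `[a, b] -> p y <= P.
  move=> yab; apply: sup_upper_bound; last by exists y.
  split; first by exists (p y); exists y.
  have [_ [M pM]] := bp; exists M => _ [z zab <-].
  exact: le_trans (ler_norm _) (pM z zab).
have [z zab pz] := EVT_min (ltW hab) cp.
have P0 : 0 < P by exact: lt_le_trans (hp _ aab) (pP _ aab).
have /andP[N0 NH] := hN.
set A := \big[Num.max/0]_(1 <= j < N.+1) `|alpha j| in hD.
have alphaA j : (1 <= j <= N)%N -> `|alpha j| <= A.
  move=> jN; apply: (@le_bigmax_seq _ R _ _ 0 j xpredT (fun j => `|alpha j|)) => //.
  by rewrite mem_index_iota.
have alpha1A : `|alpha 1| <= A by apply: alphaA; rewrite N0.
have A0 : 0 <= A by exact: le_trans (normr_ge0 _) alpha1A.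
have na := normr_ge0 a; have nb := normr_ge0 b; have nf := normr_ge0 (f a).
(* Every size condition of [setting] follows from this linear consequence of the formula for [D]. *)
have D_ge : `|f a| + 2 * A + `|a| + `|b| + 2 <= D.
  have : 0 <= A * (`|a| + `|b|) by rewrite mulr_ge0// addr_ge0.
  by rewrite hD; lra.
have a_abs : - `|a| <= a <= `|a| by rewrite -ler_norml.
have b_abs : - `|b| <= b <= `|b| by rewrite -ler_norml.
have x_in i : (i <= N)%N -> a <= x i <= b by exact: break_in.
have [m m0 mP] := @finite_pos_lower_bound R N.+1 (fun i => (0 < i)%N)
  (fun i => x i - x i.-1)
  (fun i iN i0 => etrans (subr_gt0 _ _) (hx _ (introT andP (conj i0 iN)))).
have [beta0 beta00 beta0P] := @finite_pos_lower_bound R N.+1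
  (fun j => slope_jump N alpha j != 0) (fun j => `|slope_jump N alpha j|)
  (fun j _ h => etrans (normr_gt0 _) h).
(* Each piece has length at least [4 * lam], so the interval of radius [lam] at its midpoint keeps
   distance [lam] from both ends; the two outer knots are at distance 1 from the segment. *)
pose lam := Num.min 1 (m / 4).
have lam1 : lam <= 1 by rewrite ge_min lexx.
have lamm : lam <= m / 4 by rewrite ge_min lexx orbT.
have lam0 : 0 < lam by rewrite lt_min ltr01 divr_gt0.
pose mid i := (x i.-1 + x i) / 2.
have jump_le j : `|slope_jump N alpha j| <= 2 * A.
  rewrite /slope_jump; case: eqP => _; first lra.
  case: ifPn => [/andP[j1 jN]|_]; last by rewrite normr0; lra.
  have h1 : `|alpha j| <= A by apply: alphaA; rewrite ltnW.
  have h2 : `|alpha j.-1| <= A.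
    by apply: alphaA; rewrite -ltnS prednK ?j1 ?(leq_trans (leq_pred _))// ltnW.
  by rewrite (le_trans (ler_normB _ _))//; lra.
have knot_in j : a - 1 <= knot N a b x j <= b + 1.
  rewrite /knot; case: ifPn => _; first by lra.
  case: ifPn => [jN|_]; last by lra.
  by have /andP[h1 h2] := x_in j.-1 (leq_trans (leq_pred _) jN); lra.
have st : setting N a b f p G (knot N a b x) (slope_jump N alpha) mid (f a - alpha 1)
    D lam (p z) P beta0.
  split => //.
  - exact: hp.
  - by move=> y yab; rewrite pz ?pP.
  - by move=> y yab; apply: piecewise_affine_network yab.
  - by lra.
  - by move=> j; apply: le_trans (jump_le j) _; lra.
  - by rewrite (le_trans (ler_normB _ _))//; lra.
  - by move=> j; have := knot_in j; rewrite ler_norml; lra.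
  - move=> j y /andP[j0 jN]; rewrite in_itv/= => yab; rewrite ler_norml /knot.
    case: ifPn => _; first by lra.
    by rewrite jN; have := x_in j.-1 (leq_trans (leq_pred _) jN); lra.
  - by move=> y; rewrite in_itv/= /knot/=; lra.
  - move=> j y Nj; rewrite in_itv/= /knot leqNgt (leq_ltn_trans N0 Nj)/= leqNgt Nj/=; lra.
  - move=> j Nj; rewrite /slope_jump gtn_eqF ?(leq_ltn_trans N0 Nj)//.
    by rewrite [(j <= N)%N]leqNgt Nj andbF.
  - by rewrite lam0.
  - move=> i y /andP[i0 iN]; rewrite ler_distl /mid => yi.
    have gap := mP i iN i0; have xi := x_in i iN.
    have xi' := x_in i.-1 (leq_trans (leq_pred _) iN).
    split; first by rewrite in_itv/=; lra.
      move=> j /andP[j0 ji]; rewrite /knot; case: ifPn => _; first by lra.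
      rewrite (leq_trans ji iN).
      have : x j.-1 <= x i.-1.
        apply: (break_le hx); rewrite (leq_trans (leq_pred _) iN) andbT.
        by rewrite -ltnS !prednK.
      by lra.
    move=> j ij; have j1 : (1 < j)%N by exact: leq_ltn_trans ij.
    rewrite /knot leqNgt j1/=; case: ifPn => [jN|_]; last by lra.
    have : x i <= x j.-1.
      apply: (break_le hx); rewrite (leq_trans (leq_pred _) jN) andbT.
      by rewrite -ltnS prednK// (ltn_trans _ j1).
    by lra.
  - move=> j jN; have [Nj|jN'] := ltnP N j; last exact: beta0P.
    by move: jN; rewrite /slope_jump gtn_eqF ?(leq_ltn_trans N0 Nj)// [(j <= N)%N]leqNgt Nj andbF eqxx.
have D2 : 2 <= D by lra.
set B := _ * P in |- *.
have [B0 hmaxP] := step_size_bound N D2 P0; rewrite -/B in B0 hmaxP.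
have Binv0 : 0 < B^-1 by rewrite invr_gt0.
have [c [C [delta [c0 C0 /andP[delta0 delta1] conv]]]] := local_convergence st Binv0 hmaxP.
set theta1 := teacher _ _ _ _ in conv.
(* The teacher's entries are at most [D - 1] in absolute value and [delta <= 1 / 2], so the ball
   lies in the cube. *)
exists c, C, (ball theta1 delta); split => //.
- by exists theta1; exact: ballxx.
- exact: ball_open.
- move=> theta; rewrite -ball_normE/= => th i.
  have h1 : `|theta1 0 i - theta 0 i| < delta.
    by apply: le_lt_trans th; have := normr_rV_le (theta1 - theta) i; rewrite !mxE.
  have h2 : `|theta1 0 i| <= D - 1.
    apply: normr_param_le => [j jH|]; last by rewrite (le_trans (ler_normB _ _))//; lra.
    have kj := knot_in j; have jj := jump_le j.
    by rewrite normr1 normrN ler_norml; split; lra.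
  rewrite in_itv/= -ltr_norml; have := ler_normB (theta1 0 i) (theta1 0 i - theta 0 i).
  by rewrite opprB addrC subrK; lra.
move=> theta gamma n; rewrite -ball_normE/= distrC => th; rewrite in_itv/= => /andP[g0 gB].
(* The step from iterate [i] to [i.+1] carries the number [i.+1]. As [rho >= 0], no step exceeds
   [gamma]. *)
pose h i : R := gamma / (i.+1%:R `^ rho).
have /andP[rho0 rho1] := hrho.
have hh i : 0 < h i <= B^-1.
  have pw : 1 <= i.+1%:R `^ rho :> R.
    have i1 : 1 <= i.+1%:R :> R by rewrite ler1n.
    by have := ler_powR i1 rho0; rewrite powRr0.
  have pw0 : 0 < i.+1%:R `^ rho :> R by exact: lt_le_trans pw.
  rewrite divr_gt0//= (le_trans _ gB)// ler_pdivrMr// ler_peMr// ltW//.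
have Th0 : `|Theta theta gamma 0 - theta1| < delta by rewrite hTheta0.
have ThS i : Theta theta gamma i.+1 = Theta theta gamma i - h i *: G (Theta theta gamma i).
  by rewrite hThetaS.
(* [risk] and [loss] agree by unfolding. *)
apply: le_trans (conv h (Theta theta gamma) Th0 hh ThS n) _.
rewrite ler_wpM2l ?(ltW C0)// ler_expR !mulNr lerN2 -mulrA ler_wpM2l ?(ltW c0)//.
exact: sum_step_ge.
Qed.
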